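(* (1) Let $SO_k(2)=\{A\in SO(3)\mid A e_k=e_k\}\cong Spin(2)$ for $k=1,2$. Any element $A\in SO(3)$ can be represented as $A=A_1A_2A_1'$ with $A_1,A_1'\in SO_1(2)$ and $A_2\in SO_2(2)$. (2) Let $SU_k(2)=\{A\in SU(3)\mid A e_k=e_k\}\cong Spin(3)$ for $k=1,2$. Any element $A\in SU(3)$ can be represented as $A=A_1A_2A_1'$ with $A_1,A_1'\in SU_1(2)$ and $A_2\in SU_2(2)$. (3) Let $Sp_k(2)=\{A\in Sp(3)\mid A e_k=e_k\}\cong Spin(5)$ for $k=1,2$. Any element $A\in Sp(3)$ can be represented as $A=A_1A_2A_1'$ with $A_1,A_1'\in Sp_1(2)$ and $A_2\in Sp_2(2)$.
   Context: $\mathbb{H}$ is the field of quaternions, and $M(n,K)$ is the set of $n\times n$ matrices with entries in $K=\mathbb{R},\mathbb{C},\mathbb{H}$. $A^*={}^t\overline{A}$ is the conjugate transpose and $E$ is the unit matrix. $SO(n)=\{A\in M(n,\mathbb{R})\mid {}^tAA=E,\ \det A=1\}$, $SU(n)=\{A\in M(n,\mathbb{C})\mid A^*A=E,\ \det A=1\}$, $Sp(n)=\{A\in M(n,\mathbb{H})\mid A^*A=E\}$. Matrices act on column vectors by left multiplication; $e_1={}^t(1,0,0)$, $e_2={}^t(0,1,0)$. $Spin(n)$ denotes the usual compact spinor group. *)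

(* Defs.v *)
From HB Require Import structures.
From mathcomp Require Import all_boot all_order all_algebra.
From mathcomp Require Import sesquilinear spectral.
From mathcomp Require Import all_classical all_reals all_analysis.
From mathcomp Require Import complex.
From mathcomp Require Import ring.

Set Implicit Arguments.
Unset Strict Implicit.
Unset Printing Implicit Defensive.

Import Order.TTheory GRing.Theory Num.Theory.
Import numFieldNormedType.Exports.

Local Open Scope classical_set_scope.
Local Open Scope ring_scope.

(* The topology of the norm of R[i], which R[i]^o already carries. *)
HB.instance Definition _ (R : realType) := Uniform.copy R[i] R[i]^o.

(* (a, b, c, d) stands for a + bi + cj + dk; the topology is that of R^4. *)
Definition quat (R : realType) : Type := (R * R * R * R)%type.

HB.instance Definition _ (R : realType) :=
  GRing.Zmodule.copy (quat R) (R * R * R * R)%type.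
HB.instance Definition _ (R : realType) :=
  Uniform.copy (quat R) (R * R * R * R)%type.

Section QuaternionRing.
Variable R : realType.
Implicit Types x y z : quat R.

Definition quat_one : quat R := (1, 0, 0, 0).

Definition quat_mul x y : quat R :=
  let: (a, b, c, d) := x in
  let: (a', b', c', d') := y in
  (a * a' - b * b' - c * c' - d * d',
   a * b' + b * a' + c * d' - d * c',
   a * c' - b * d' + c * a' + d * b',
   a * d' + b * c' - c * b' + d * a').

Definition quat_conj x : quat R :=
  let: (a, b, c, d) := x in (a, - b, - c, - d).

Lemma quat_mulA : associative quat_mul.
Proof.
move=> [[[a b] c] d] [[[a' b'] c'] d'] [[[a'' b''] c''] d''].
by congr (_, _, _, _); rewrite /=; ring.
Qed.

Lemma quat_mul1l : left_id quat_one quat_mul.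
Proof. by move=> [[[a b] c] d]; congr (_, _, _, _); ring. Qed.

Lemma quat_mul1r : right_id quat_one quat_mul.
Proof. by move=> [[[a b] c] d]; congr (_, _, _, _); ring. Qed.

Lemma quat_mulDl : left_distributive quat_mul +%R.
Proof.
move=> [[[a b] c] d] [[[a' b'] c'] d'] [[[a'' b''] c''] d''].
by congr (_, _, _, _); rewrite /=; ring.
Qed.

Lemma quat_mulDr : right_distributive quat_mul +%R.
Proof.
move=> [[[a b] c] d] [[[a' b'] c'] d'] [[[a'' b''] c''] d''].
by congr (_, _, _, _); rewrite /=; ring.
Qed.

Lemma quat_one_neq0 : quat_one != 0.
Proof. by apply/eqP=> -[] /eqP; rewrite oner_eq0. Qed.

HB.instance Definition _ := GRing.Zmodule_isNzRing.Build (quat R)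
  quat_mulA quat_mul1l quat_mul1r quat_mulDl quat_mulDr quat_one_neq0.

End QuaternionRing.

Section MatrixGroups.
Variable R : realType.

Definition SO n : set 'M[R]_n :=
  [set A | A^T *m A = 1%:M /\ \det A = 1].

Definition SU n : set 'M[R[i]]_n :=
  [set A | (A ^t*)%sesqui *m A = 1%:M /\ \det A = 1].

Definition Sp n : set 'M[quat R]_n :=
  [set A | map_mx (@quat_conj R) A^T *m A = 1%:M].

(* k is numbered from 1: basis_vec K 1 is the column (1, 0, 0). *)
Definition basis_vec (K : nzRingType) (k : nat) : 'cV[K]_3 :=
  \col_(i < 3) (i.+1 == k)%:R.

Definition SO_ (k : nat) : set 'M[R]_3 :=
  [set A | SO A /\ A *m basis_vec R k = basis_vec R k].

Definition SU_ (k : nat) : set 'M[R[i]]_3 :=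
  [set A | SU A /\ A *m basis_vec R[i] k = basis_vec R[i] k].

Definition Sp_ (k : nat) : set 'M[quat R]_3 :=
  [set A | Sp A /\ A *m basis_vec (quat R) k = basis_vec (quat R) k].

End MatrixGroups.

Arguments SO : clear implicits.
Arguments SU : clear implicits.
Arguments Sp : clear implicits.
Arguments SO_ : clear implicits.
Arguments SU_ : clear implicits.
Arguments Sp_ : clear implicits.

(* The Clifford algebra of R^n with v * v = - |v|^2, as the real vector space
   with basis the e_S = e_{i_1} ... e_{i_p}, for S = {i_1 < ... < i_p} a subset
   of 'I_n; the coordinate along e_S sits at position enum_rank S. *)
Definition clifford (R : realType) (n : nat) : Type :=
  'rV[R]_#|{set 'I_n}|.

HB.instance Definition _ (R : realType) n :=
  GRing.Lmodule.copy (clifford R n) 'rV[R]_#|{set 'I_n}|.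
HB.instance Definition _ (R : realType) n :=
  Uniform.copy (clifford R n) 'rV[R]_#|{set 'I_n}|.

Section CliffordRing.
Variables (R : realType) (n : nat).
Implicit Types (x y z : clifford R n) (S T U : {set 'I_n}).

Definition cl_coord x S : R := (x : 'rV_ _) 0 (enum_rank S).

Definition cl_build (f : {set 'I_n} -> R) : clifford R n :=
  \row_j f (enum_val j).

Definition symdiff S T : {set 'I_n} := (S :\: T) :|: (T :\: S).

(* e_S * e_T = cl_sign S T *: e_(symdiff S T): moving the factors of e_T into
   place costs a sign for each pair j < i, and e_i * e_i = -1 one for j = i. *)
Definition cl_sign S T : R :=
  \prod_(i in S) \prod_(j in T | (j <= i)%N) (-1).

Definition cl_one : clifford R n := cl_build (fun S => (S == finset.set0)%:R).

Definition cl_mul x y : clifford R n :=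
  cl_build (fun U => \sum_S
    cl_sign S (symdiff S U) * cl_coord x S * cl_coord y (symdiff S U)).

Lemma cl_buildK f : cl_coord (cl_build f) =1 f.
Proof. by move=> S; rewrite /cl_coord /cl_build mxE enum_rankK. Qed.

Lemma cl_eqP x y : cl_coord x =1 cl_coord y -> x = y.
Proof.
by move=> exy; apply/rowP=> j; have := exy (enum_val j);
   rewrite /cl_coord enum_valK.
Qed.

Lemma cl_coordD x y S : cl_coord (x + y) S = cl_coord x S + cl_coord y S.
Proof. by rewrite /cl_coord mxE. Qed.

Lemma in_symdiff i S T : (i \in symdiff S T) = (i \in S) (+) (i \in T).
Proof. by rewrite !inE; case: (i \in S); case: (i \in T). Qed.

Lemma symdiffA : associative symdiff.
Proof. by move=> S T U; apply/finset.setP=> i; rewrite !in_symdiff addbA. Qed.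

Lemma symdiffC : commutative symdiff.
Proof. by move=> S T; apply/finset.setP=> i; rewrite !in_symdiff addbC. Qed.

Lemma symdiffK S : involutive (symdiff S).
Proof. by move=> T; apply/finset.setP=> i; rewrite !in_symdiff addKb. Qed.

Lemma symdiff0 S : symdiff S finset.set0 = S.
Proof. by apply/finset.setP=> i; rewrite in_symdiff inE addbF. Qed.

Lemma symdiff_self S : symdiff S S = finset.set0.
Proof. by apply/finset.setP=> i; rewrite in_symdiff inE addbb. Qed.

Lemma cl_signDl S T U :
  cl_sign (symdiff S T) U = cl_sign S U * cl_sign T U.
Proof.
rewrite /cl_sign big_mkcond [X in _ = X * _]big_mkcond.
rewrite [X in _ = _ * X]big_mkcond -big_split; apply: eq_bigr => i _ /=.
rewrite in_symdiff; case: (i \in S); case: (i \in T); rewrite ?(mul1r, mulr1)//.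
by rewrite -big_split /= big1// => j _; rewrite mulrNN mulr1.
Qed.

Lemma cl_signDr S T U :
  cl_sign U (symdiff S T) = cl_sign U S * cl_sign U T.
Proof.
rewrite /cl_sign -big_split; apply: eq_bigr => i _ /=.
rewrite big_mkcondr [X in _ = X * _]big_mkcondr [X in _ = _ * X]big_mkcondr.
rewrite big_mkcond [X in _ = X * _]big_mkcond [X in _ = _ * X]big_mkcond.
rewrite -big_split; apply: eq_bigr => j _ /=.
rewrite in_symdiff; case: (j \in S); case: (j \in T); rewrite ?(mul1r, mulr1)//.
by case: ifP; rewrite ?mulrNN mulr1.
Qed.

Lemma cl_sign0l S : cl_sign finset.set0 S = 1.
Proof. by rewrite /cl_sign big_set0. Qed.

Lemma cl_sign0r S : cl_sign S finset.set0 = 1.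
Proof.
by rewrite /cl_sign big1// => i _; rewrite big_pred0// => j; rewrite inE.
Qed.

Lemma cl_mulA : associative cl_mul.
Proof.
move=> x y z; apply: cl_eqP => U; rewrite !cl_buildK.
transitivity (\sum_S \sum_T cl_sign S (symdiff S U) * cl_coord x S *
  (cl_sign T (symdiff T (symdiff S U)) * cl_coord y T
   * cl_coord z (symdiff T (symdiff S U)))).
  by apply: eq_bigr => S _; rewrite cl_buildK mulr_sumr.
under [RHS]eq_bigr => W _ do rewrite cl_buildK mulr_sumr mulr_suml.
rewrite [RHS]exchange_big; apply: eq_bigr => S _ /=.
rewrite [RHS](reindex_inj (inv_inj (@symdiffK S))); apply: eq_bigr => T _ /=.
rewrite symdiffK [symdiff T (symdiff S U)]symdiffA [symdiff T S]symdiffC.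
set V := symdiff (symdiff S T) U.
have -> : symdiff S U = symdiff T V.
  by rewrite /V (symdiffC S T) -symdiffA symdiffK.
rewrite cl_signDl cl_signDr; ring.
Qed.

Lemma cl_mul1l : left_id cl_one cl_mul.
Proof.
move=> x; apply: cl_eqP => U; rewrite cl_buildK (bigD1 finset.set0)//= big1.
  by rewrite cl_buildK eqxx cl_sign0l !mul1r addr0 symdiffC symdiff0.
by move=> S /negPf S0; rewrite cl_buildK S0 mulr0 mul0r.
Qed.

Lemma cl_mul1r : right_id cl_one cl_mul.
Proof.
move=> x; apply: cl_eqP => U; rewrite cl_buildK (bigD1 U)//= big1.
  by rewrite cl_buildK symdiff_self eqxx cl_sign0r mulr1 mul1r addr0.
move=> S SU; rewrite cl_buildK; case: eqP => [/(congr1 (symdiff S))|].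
  by rewrite symdiffK symdiff0 => US; rewrite US eqxx in SU.
by rewrite mulr0.
Qed.

Lemma cl_mulDl : left_distributive cl_mul +%R.
Proof.
move=> x y z; apply: cl_eqP => U; rewrite cl_coordD !cl_buildK -big_split.
by apply: eq_bigr => S _; rewrite cl_coordD mulrDr mulrDl.
Qed.

Lemma cl_mulDr : right_distributive cl_mul +%R.
Proof.
move=> x y z; apply: cl_eqP => U; rewrite cl_coordD !cl_buildK -big_split.
by apply: eq_bigr => S _; rewrite cl_coordD mulrDr.
Qed.

Lemma cl_one_neq0 : cl_one != 0.
Proof.
apply/eqP=> /(congr1 (cl_coord ^~ finset.set0)) /eqP.
by rewrite cl_buildK eqxx /cl_coord mxE oner_eq0.
Qed.

HB.instance Definition _ := GRing.Zmodule_isNzRing.Build (clifford R n)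
  cl_mulA cl_mul1l cl_mul1r cl_mulDl cl_mulDr cl_one_neq0.

Definition cl_vec (v : 'rV[R]_n) : clifford R n :=
  cl_build (fun S => \sum_(i < n | S == [set i]%SET) v 0 i).

Lemma cl_vec_sqr v :
  cl_vec v * cl_vec v = (- \sum_(i < n) v 0 i ^+ 2) *: (1 : clifford R n).
Proof.
apply: cl_eqP => U; rewrite cl_buildK.
have -> : cl_coord ((- \sum_(i < n) v 0 i ^+ 2) *: (1 : clifford R n)) U =
    - (\sum_(i < n) v 0 i ^+ 2) * (U == finset.set0)%:R.
  by rewrite /cl_coord mxE; congr (_ * _); apply: cl_buildK.
pose g i j : R := (U == symdiff [set i]%SET [set j]%SET)%:R *
  cl_sign [set i]%SET [set j]%SET * (v 0 i * v 0 j).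
have signE i j : cl_sign [set i]%SET [set j]%SET = (-1) ^+ (j <= i)%N.
  rewrite /cl_sign big_set1 big_mkcondr big_set1.
  by case: (j <= i)%N; rewrite ?expr1.
transitivity (\sum_i \sum_j g i j).
  under eq_bigr => S _ do rewrite cl_buildK mulr_sumr mulr_suml big_mkcond.
  rewrite exchange_big; apply: eq_bigr => i _ /=.
  rewrite (bigD1 [set i]%SET)//= eqxx big1 ?addr0; last first.
    by move=> S /negPf ->.
  rewrite cl_buildK mulr_sumr big_mkcond; apply: eq_bigr => j _; rewrite /g.
  have -> : (symdiff [set i]%SET U == [set j]%SET) =
      (U == symdiff [set i]%SET [set j]%SET).
    by apply/eqP/eqP => [<-|->]; rewrite symdiffK.
  by case: eqP => [->|]; rewrite ?(symdiffK, mul0r)//= mul1r mulrA.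
have gC i j : i != j -> g i j = - g j i.
  rewrite /g !signE symdiffC neq_ltn => ij.
  suff -> : (-1) ^+ (j <= i)%N = - (-1) ^+ (i <= j)%N :> R by ring.
  by case/orP: ij => ij; rewrite (ltnW ij) leqNgt ij /= ?opprK.
rewrite -sumrN mulr_suml.
transitivity (\sum_i \sum_(j | j == i) g i j); last first.
  apply: eq_bigr => i _; rewrite big_pred1_eq /g signE symdiff_self leqnn.
  by rewrite expr1 expr2; ring.
apply/eqP; rewrite -subr_eq0 -sumrB.
under eq_bigr => i _ do rewrite (bigID (fun j => j == i)) /= addrC addrK.
set X := \sum_i _; suff : X = - X.
  by move/eqP; rewrite -addr_eq0 -mulr2n mulrn_eq0.
rewrite {1}/X (exchange_big_dep xpredT)//= -sumrN; apply: eq_bigr => i _.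
rewrite -sumrN; apply: eq_big => [j|j ij]; first by rewrite eq_sym.
by rewrite (gC i j)// opprK.
Qed.

End CliffordRing.

Definition Spin (R : realType) (n : nat) : set (clifford R n) :=
  [set x | exists s : seq 'rV[R]_n,
    [/\ ~~ odd (size s),
        forall v, v \in s -> \sum_(i < n) v 0 i ^+ 2 = 1
      & x = \prod_(v <- s) cl_vec v]].

Arguments Spin : clear implicits.

(* G and H, groups for the operations mulT and mulU, are isomorphic as
   topological groups; for closed matrix groups this is the same as being
   isomorphic as Lie groups. *)
Definition top_group_iso (T U : topologicalType)
    (G : set T) (H : set U) (mulT : T -> T -> T) (mulU : U -> U -> U) : Prop :=
  exists (f : T -> U) (g : U -> T),
    [/\ set_fun G H f /\ set_fun H G g,
        (forall x, G x -> g (f x) = x) /\ (forall y, H y -> f (g y) = y),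
        forall x y, G x -> G y -> f (mulT x y) = mulU (f x) (f y),
        {within G, continuous f}
      & {within H, continuous g}].

(* Main.v *)
Require Import Defs.
From HB Require Import structures.
From mathcomp Require Import finmap.
From mathcomp Require Import all_boot all_order all_algebra.
From mathcomp Require Import sesquilinear spectral.
From mathcomp Require Import all_classical all_reals all_analysis.
From mathcomp Require Import complex.
From mathcomp Require Import ring lra.

Set Implicit Arguments.
Unset Strict Implicit.
Unset Printing Implicit Defensive.

Import Order.TTheory GRing.Theory Num.Theory.
Import numFieldNormedType.Exports.

Local Open Scope classical_set_scope.
Local Open Scope ring_scope.

(* Let K be R, C or H, of real dimension n - 1, with conjugation x |-> x'. The
   Hermitian matrices X = [[t, w], [w', -t]], t real and w in K, form an R^n in
   M_2(K) on which squaring is the squared length; doubling them to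
   [[0, X], [-X, 0]] gives a representation of the Clifford algebra in M_4(K),
   which is injective because the monomials are orthogonal for the trace form.
   Even words in unit vectors go to block diagonal matrices diag(Y, Y), so
   Spin(n) embeds in the 2 x 2 unitary group of K by a linear map with a linear
   left inverse.

   The image acts transitively on the unit vectors of K^2: it contains every
   diag(p, p') with |p| = 1 and every [[t, w], [-w', t]] with t real. It is thus
   all of SO(2), SU(2), Sp(2) once it contains the diag(1, q) of the group: for
   R and C the determinant forces q = 1; for H write q = p^2 and p = u v with
   u, v imaginary units, so that
   diag(1, q) = diag(p', p) diag(u, u') diag(v, v').

   Transitivity also gives the decomposition: if A e_1 = (a, b, c), some A_1
   fixing e_1 sends (a, 0, s) to (a, b, c), with s = |(b, c)|, and some A_2
   fixing e_2 sends e_1 to (a, 0, s); then A_2^-1 A_1^-1 A fixes e_1. *)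

(** * Representations of the Clifford algebra *)

Section CliffordRepresentation.
Variables (R : realType) (n : nat) (B : nzRingType).
Variable iota : {rmorphism R -> B}.
Hypothesis iotaC : forall r b, iota r * b = b * iota r.
Variable g : 'I_n -> B.
Hypothesis gg : forall i, g i * g i = -1.
Hypothesis gC : forall i j, i != j -> g i * g j = - (g j * g i).
Implicit Types (x y : clifford R n) (S T U : {set 'I_n}).

Definition monom S : B := \prod_(i <- enum 'I_n | i \in S) g i.

Lemma monom0 : monom finset.set0 = 1.
Proof. by rewrite /monom big1// => i; rewrite inE. Qed.

(** The scalars picked up while [h] moves across the factors are central, so they collect in
    front. *)
Lemma prod_signC (c : 'I_n -> R) (h : B) (r : seq 'I_n) S :
  (forall i, i \in r -> i \in S -> h * g i = iota (c i) * (g i * h)) ->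
  h * (\prod_(i <- r | i \in S) g i) =
  iota (\prod_(i <- r | i \in S) c i) * ((\prod_(i <- r | i \in S) g i) * h).
Proof.
elim: r => [|k r IH] hc; first by rewrite !big_nil rmorph1 !mul1r mulr1.
rewrite !big_cons; case: ifPn => kS; last first.
  by apply: IH => i ir; apply: hc; rewrite inE ir orbT.
rewrite mulrA hc ?mem_head// -!mulrA IH; last first.
  by move=> i ir; apply: hc; rewrite inE ir orbT.
rewrite rmorphM -!mulrA; congr (_ * _).
by rewrite [in RHS]mulrA [in RHS]iotaC -!mulrA; congr (_ * _);
  rewrite mulrA -iotaC mulrA.
Qed.

Lemma pairwise_enum_ord : pairwise (fun i j : 'I_n => (i < j)%N) (enum 'I_n).
Proof.
have := iota_ltn_sorted 0 n; rewrite -val_enum_ord sorted_map.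
by rewrite sorted_pairwise// => i j k /=; exact: ltn_trans.
Qed.

(** The generators below [k] anticommute with [g k], each giving one of the signs counted by
    [cl_sign]; arriving at its place, [g k] is either inserted or meets itself and squares to -1. *)
Lemma mul_gen_monom k S :
  g k * monom S =
  iota (cl_sign R [set k]%SET S) * monom (symdiff [set k]%SET S).
Proof.
have -> : cl_sign R [set k]%SET S =
    \prod_(j <- enum 'I_n | (j \in S) && (j <= k)%N) (-1).
  by rewrite /cl_sign big_set1 big_enum_cond.
rewrite /monom; have := pairwise_enum_ord.
(* The enumeration splits at [k] into the smaller indices [p1] and the larger ones [p2]; only [p1]
   is crossed. *)
case/splitPr: (mem_enum 'I_n k) => p1 p2.
rewrite pairwise_cat /= => /and4P[/allrelP p1k _ kp2 _].
rewrite !big_cat !big_cons /=.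
have -> : \prod_(j <- p2 | (j \in S) && (j <= k)%N) (-1) = 1 :> R.
  rewrite big_seq_cond big1// => j /and3P[jp2 _].
  by rewrite leqNgt (allP kp2 _ jp2).
have p1lt j : j \in p1 -> (j < k)%N by move=> ?; apply: p1k; rewrite ?mem_head.
have -> : \prod_(j <- p1 | (j \in S) && (j <= k)%N) (-1) =
          \prod_(j <- p1 | j \in S) (-1) :> R.
  rewrite big_seq_cond [RHS]big_seq_cond; apply: eq_bigl => j.
  by case jp1: (j \in p1) => //=; rewrite (ltnW (p1lt _ jp1)) andbT.
have -> : \prod_(i <- p1 | i \in symdiff [set k]%SET S) g i =
          \prod_(i <- p1 | i \in S) g i.
  rewrite big_seq_cond [RHS]big_seq_cond; apply: eq_bigl => j.
  case jp1: (j \in p1) => //=; rewrite in_symdiff inE.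
  by have := p1lt _ jp1; case: eqP => // ->; rewrite ltnn.
have -> : \prod_(i <- p2 | i \in symdiff [set k]%SET S) g i =
          \prod_(i <- p2 | i \in S) g i.
  rewrite big_seq_cond [RHS]big_seq_cond; apply: eq_bigl => j.
  case jp2: (j \in p2) => //=; rewrite in_symdiff inE.
  by have := allP kp2 _ jp2; case: eqP => // ->; rewrite ltnn.
rewrite mulrA (prod_signC (c := fun=> -1)); last first.
  move=> i ip1 _; rewrite gC ?rmorphN1 ?mulN1r//.
  by apply: contraTneq (p1lt _ ip1) => ->; rewrite ltnn.
rewrite in_symdiff inE eqxx leqnn andbT mulr1.
case: (k \in S) => /=; last by rewrite mulr1 -!mulrA.
rewrite mulrN1 rmorphN mulNr -!mulrA -mulrN -mulrN; congr (_ * (_ * _)).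
by rewrite mulrA gg mulN1r.
Qed.

Lemma monomM S T :
  monom S * monom T = iota (cl_sign R S T) * monom (symdiff S T).
Proof.
(* The induction strips the smallest index of an increasing list [r], so [S] is replaced by its part
   lying in [r]. *)
pose S_ (r : seq 'I_n) : {set 'I_n} := [set i in r | i \in S]%SET.
suff /(_ (enum 'I_n) pairwise_enum_ord) : forall r : seq 'I_n,
    pairwise (fun i j : 'I_n => (i < j)%N) r ->
    (\prod_(i <- r | i \in S) g i) * monom T =
    iota (cl_sign R (S_ r) T) * monom (symdiff (S_ r) T).
  suff -> : S_ (enum 'I_n) = S by [].
  by apply/finset.setP => i; rewrite inE mem_enum.
elim=> [|k r IH] /=.
  move=> _; have -> : S_ [::] = finset.set0.
    by apply/finset.setP => i; rewrite !inE.
  by rewrite big_nil cl_sign0l symdiffC symdiff0 rmorph1.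
case/andP=> kr /IH{}IH; rewrite big_cons; case: ifPn => kS; last first.
  rewrite IH; suff -> : S_ (k :: r) = S_ r by [].
  apply/finset.setP => i; rewrite !inE.
  by case: eqP => //= ->; rewrite (negPf kS) andbF.
have -> : S_ (k :: r) = symdiff [set k]%SET (S_ r).
  apply/finset.setP => i; rewrite in_symdiff !inE.
  case: eqP => [->|] //=; rewrite kS andbT.
  by case: (boolP (k \in r)) => // /(allP kr); rewrite ltnn.
rewrite -mulrA IH mulrA -iotaC -mulrA mul_gen_monom mulrA -rmorphM symdiffA.
congr (iota _ * _); rewrite cl_signDl cl_signDr.
(* [k] is smaller than every remaining index, so placing it in front costs no sign. *)
suff -> : cl_sign R [set k]%SET (S_ r) = 1 by rewrite mul1r mulrC.
rewrite /cl_sign big_set1 big1// => j; rewrite !inE => /andP[/andP[jr _]].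
by rewrite leqNgt (allP kr _ jr).
Qed.

Lemma cl_sign_sqr S T : cl_sign R S T * cl_sign R S T = 1.
Proof. by rewrite -cl_signDl symdiff_self cl_sign0l. Qed.

Variable tau : {additive B -> R}.
Hypothesis tauZ : forall r b, tau (iota r * b) = r * tau b.
Hypothesis tauC : forall a b, tau (a * b) = tau (b * a).
Hypothesis tau1 : tau 1 != 0.
(* A grading element, needed for the monomials of odd length: when n is odd the
   top monomial commutes with every generator and could have nonzero trace. *)
Variable omega : B.
Hypothesis omega2 : omega * omega = 1.
Hypothesis omegaC : forall i, omega * g i = - (g i * omega).

(** Conjugation by [h] negates [b] but preserves its trace, which is therefore its own opposite. *)
Lemma tau_anticomm h h' b : h' * h = 1 -> h * h' = 1 ->
  h * b = - (b * h) -> tau b = 0.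
Proof.
move=> h'h hh' hb; apply/eqP.
have : tau b = - tau b.
  by rewrite -{1}[b]mul1r -h'h -mulrA hb mulrN raddfN tauC -mulrA hh' mulr1.
by move/eqP; rewrite -addr_eq0 -mulr2n mulrn_eq0.
Qed.

Lemma tau_monom S : tau (monom S) = tau 1 * (S == finset.set0)%:R.
Proof.
have [->|Sn0] := eqVneq S finset.set0; first by rewrite monom0 mulr1.
rewrite mulr0.
have sgn (c : 'I_n -> R) :
    \prod_(i <- enum 'I_n | i \in S) c i = \prod_(i in S) c i.
  by rewrite big_enum_cond.
(* An odd monomial anticommutes with [omega]; a nonempty even one anticommutes with any [g k] it
   contains, which commutes with itself and passes an odd number of others. *)
case oS: (odd #|S|).
  apply: (tau_anticomm omega2 omega2).
  rewrite (prod_signC (c := fun=> -1)).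
    by rewrite sgn prodr_const -signr_odd oS expr1 rmorphN1 mulN1r.
  by move=> i _ _; rewrite omegaC rmorphN1 mulN1r.
have [k kS] := set0Pn S Sn0.
have ginv : - g k * g k = 1 /\ g k * - g k = 1.
  by rewrite mulNr mulrN gg opprK.
apply: (tau_anticomm ginv.1 ginv.2).
rewrite (prod_signC (c := fun i => if i == k then 1 else -1)).
  rewrite sgn (bigD1 k)//= eqxx mul1r (eq_bigr (fun=> -1)); last first.
    by move=> i /andP[_ /negPf ->].
  suff -> : \prod_(i in S | i != k) (-1) = -1 :> R by rewrite rmorphN1 mulN1r.
  have -> : \prod_(i in S | i != k) (-1) = \prod_(i in S :\ k) (-1) :> R.
    by apply: eq_bigl => i; rewrite !inE andbC.
  rewrite prodr_const; have := cardsD1 k S; rewrite kS => cS.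
  rewrite -signr_odd; move: oS; rewrite cS add1n oddS => /negbFE ->.
  by rewrite expr1.
move=> i _ _; have [->|ik] := eqVneq i k; first by rewrite rmorph1 mul1r.
by rewrite rmorphN1 mulN1r gC// eq_sym.
Qed.

Definition cl_rep x : B := \sum_S iota (cl_coord x S) * monom S.

(* Up to the sign [cl_sign S S], the monomial of S is its own inverse; hence the
   coefficient of x along e_S is a trace of its image times that monomial. *)
Definition cl_unrep (b : B) : clifford R n :=
  cl_build (fun S => cl_sign R S S / tau 1 * tau (monom S * b)).

Lemma cl_repK : cancel cl_rep cl_unrep.
Proof.
move=> x; apply: cl_eqP => S; rewrite cl_buildK /cl_rep mulr_sumr raddf_sum.
rewrite (bigD1 S)//= big1 ?addr0.
  rewrite [X in _ * tau X]mulrA -iotaC -[X in _ * tau X]mulrA tauZ monomM tauZ.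
  rewrite symdiff_self tau_monom eqxx.
  rewrite mulr1 -[RHS]mul1r -(cl_sign_sqr S S); field.
  exact: tau1.
(* For [T] other than [S] the product is a signed monomial over a nonempty set, which has trace
   zero. *)
move=> T TS; rewrite [X in tau X]mulrA -iotaC -[X in tau X]mulrA.
rewrite tauZ monomM tauZ tau_monom.
case: eqP => [/(congr1 (symdiff S))|_]; last by rewrite !mulr0.
by rewrite symdiffK symdiff0 => /eqP; rewrite (negPf TS).
Qed.

Lemma cl_rep1 : cl_rep 1 = 1.
Proof.
rewrite /cl_rep (bigD1 finset.set0)//= big1 => [|S S0].
  by rewrite cl_buildK eqxx rmorph1 mul1r monom0 addr0.
by rewrite cl_buildK (negPf S0) rmorph0 mul0r.
Qed.

Definition gen_vec (v : 'rV[R]_n) : B := \sum_i iota (v 0 i) * g i.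

Lemma cl_repM x y : cl_rep (x * y) = cl_rep x * cl_rep y.
Proof.
rewrite /cl_rep mulr_suml.
transitivity (\sum_U \sum_S
   iota (cl_coord x S) * iota (cl_coord y (symdiff S U)) *
   (iota (cl_sign R S (symdiff S U)) * monom U)).
  apply: eq_bigr => U _; rewrite cl_buildK rmorph_sum mulr_suml.
  apply: eq_bigr => S _; rewrite !rmorphM -!mulrA.
  rewrite iotaC -!mulrA; congr (_ * _); congr (_ * _).
  by rewrite -iotaC.
rewrite exchange_big; apply: eq_bigr => S _ /=; rewrite mulr_sumr.
(* For fixed [S], the index set [symdiff S U] of the second factor becomes the summation
   variable. *)
rewrite (reindex_inj (inv_inj (@symdiffK _ S))); apply: eq_bigr => T _ /=.
rewrite symdiffK -monomM -!mulrA; congr (_ * _).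
by rewrite !mulrA iotaC.
Qed.

Lemma cl_rep_vec v : cl_rep (cl_vec v) = gen_vec v.
Proof.
rewrite /cl_rep /gen_vec.
under eq_bigr => S _ do rewrite cl_buildK rmorph_sum mulr_suml big_mkcond.
rewrite exchange_big; apply: eq_bigr => i _ /=.
rewrite -big_mkcond big_pred1_eq; congr (_ * _).
have := mul_gen_monom i finset.set0.
by rewrite monom0 mulr1 cl_sign0r rmorph1 mul1r symdiff0 => ->.
Qed.
End CliffordRepresentation.

(** * Matrix and topology preliminaries *)

Section SpinGroup.
Variables (R : realType) (n : nat).
Implicit Types (v w : 'rV[R]_n) (x y : clifford R n).

Definition sqnorm v : R := \sum_(i < n) v 0 i ^+ 2.

Lemma Spin1 : Spin R n 1.
Proof. by exists [::]; split=> //; rewrite big_nil. Qed.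

Lemma SpinM x y : Spin R n x -> Spin R n y -> Spin R n (x * y).
Proof.
move=> [s [os us ->]] [t [ot ut ->]]; exists (s ++ t).
split; last by rewrite big_cat.
  by rewrite size_cat oddD (negPf os) (negPf ot).
by move=> v; rewrite mem_cat => /orP[/us|/ut].
Qed.

Lemma Spin_vec2 v w : sqnorm v = 1 -> sqnorm w = 1 ->
  Spin R n (cl_vec v * cl_vec w).
Proof.
move=> v1 w1; exists [:: v; w].
split=> //; last by rewrite !big_cons big_nil mulr1.
by move=> u; rewrite !inE => /orP[]/eqP ->.
Qed.

(** Letters are taken in pairs because the properties needed later, such as being block diagonal,
    hold for a product of two vectors but not for a single one. *)
Lemma Spin_ind (Q : clifford R n -> Prop) :
  Q 1 ->
  (forall v w x, sqnorm v = 1 -> sqnorm w = 1 -> Q x ->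
     Q (cl_vec v * cl_vec w * x)) ->
  forall x, Spin R n x -> Q x.
Proof.
move=> Q1 QM x [s [os us ->]].
have [m] := ubnP (size s); elim: m s os us => // m IH [|v [|w s]]//= os us.
  by rewrite big_nil.
rewrite negbK in os; move=> sm; rewrite !big_cons mulrA; apply: QM.
- by apply: us; rewrite mem_head.
- by apply: us; rewrite !inE eqxx orbT.
- apply: IH => //; last by rewrite ltnS in sm; exact: leq_trans (leqnSn _) sm.
  by move=> u su; apply: us; rewrite !inE su !orbT.
Qed.

End SpinGroup.

(** * Conjugate transposes over a ring with involution *)

Section StarMatrix.
Variables (K : nzRingType) (conj : {additive K -> K}).
Hypothesis conjM : forall x y, conj (x * y) = conj y * conj x.
Hypothesis conjK : involutive conj.

Definition star m n (A : 'M[K]_(m, n)) : 'M[K]_(n, m) := map_mx conj A^T.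

Lemma starM m n p (A : 'M[K]_(m, n)) (B : 'M[K]_(n, p)) :
  star (A *m B) = star B *m star A.
Proof.
apply/matrixP => i j; rewrite !mxE raddf_sum; apply: eq_bigr => k _.
by rewrite conjM !mxE.
Qed.

Lemma starK m n (A : 'M[K]_(m, n)) : star (star A) = A.
Proof. by apply/matrixP => i j; rewrite !mxE conjK. Qed.

Lemma conj1 : conj 1 = 1.
Proof. by rewrite -[conj 1]mulr1 -{2}[1]conjK -conjM mulr1 conjK. Qed.

Lemma star1 n : star (1%:M : 'M[K]_n) = 1%:M.
Proof.
by apply/matrixP => i j; rewrite !mxE eq_sym; case: eqP; rewrite ?conj1 ?raddf0.
Qed.

Definition unitary_mx n (A : 'M[K]_n) := star A *m A = 1%:M.

End StarMatrix.

Lemma ord2_case (i : 'I_2) : i = 0 \/ i = 1.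
Proof. by case: i => [[|[|//]] i2]; [left|right]; exact: val_inj. Qed.

Lemma lift00 : lift 0 0 = 1 :> 'I_2.
Proof. exact: val_inj. Qed.

Section Matrix2.
Variable K : nzRingType.
Implicit Types (a b c d : K).

Definition mx2 a b c d : 'M[K]_2 :=
  \matrix_(i, j) if i == 0 then (if j == 0 then a else b)
                 else (if j == 0 then c else d).

Lemma mx2P (A : 'M[K]_2) : A = mx2 (A 0 0) (A 0 1) (A 1 0) (A 1 1).
Proof.
by apply/matrixP => i j; rewrite mxE; case: (ord2_case i) => ->;
   case: (ord2_case j) => ->.
Qed.

Lemma mx2M a b c d a' b' c' d' : mx2 a b c d *m mx2 a' b' c' d' =
  mx2 (a * a' + b * c') (a * b' + b * d') (c * a' + d * c') (c * b' + d * d').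
Proof.
rewrite [LHS]mx2P; congr mx2;
by rewrite !mxE !big_ord_recl big_ord0 !mxE /= addr0.
Qed.

Lemma mx2D a b c d a' b' c' d' : mx2 a b c d + mx2 a' b' c' d' =
  mx2 (a + a') (b + b') (c + c') (d + d').
Proof. by rewrite [LHS]mx2P; congr mx2; rewrite !mxE. Qed.

Lemma mx2N a b c d : - mx2 a b c d = mx2 (- a) (- b) (- c) (- d).
Proof. by rewrite [LHS]mx2P; congr mx2; rewrite !mxE. Qed.

Lemma mx2Z k a b c d : k *: mx2 a b c d = mx2 (k * a) (k * b) (k * c) (k * d).
Proof. by rewrite [LHS]mx2P; congr mx2; rewrite !mxE. Qed.

Lemma mx2_1 k : k%:M = mx2 k 0 0 k.
Proof. by rewrite [LHS]mx2P; congr mx2; rewrite !mxE. Qed.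

Lemma mx2_star (conj : {additive K -> K}) a b c d :
  star conj (mx2 a b c d) = mx2 (conj a) (conj c) (conj b) (conj d).
Proof. by rewrite [LHS]mx2P; congr mx2; rewrite !mxE. Qed.

End Matrix2.

(** * Stabilisers of a coordinate vector of K^3 *)

Section Embed.
Variables (K : nzRingType) (k : 'I_3).
Implicit Types (A : 'M[K]_2) (M : 'M[K]_3).

(** The block [A] acts on the two coordinates other than [k]. Indices in ['I_3] start at 0, so the
    fixed vector is [basis_vec K k.+1]. *)
Definition emb3 A : 'M[K]_3 := \matrix_(i, j)
  match unlift k i, unlift k j with
  | Some i', Some j' => A i' j'
  | None, None => 1
  | _, _ => 0
  end.

Definition res2 M : 'M[K]_2 := \matrix_(i, j) M (lift k i) (lift k j).

Lemma emb3K : cancel emb3 res2.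
Proof. by move=> A; apply/matrixP => i j; rewrite !mxE !liftK. Qed.

Lemma ordD (i : 'I_3) : i = k \/ exists i', i = lift k i'.
Proof. by case: (unliftP k i) => [i' ->|->]; [right; exists i'|left]. Qed.

Lemma emb3_ll A i j : emb3 A (lift k i) (lift k j) = A i j.
Proof. by rewrite mxE !liftK. Qed.
Lemma emb3_lk A i : emb3 A (lift k i) k = 0.
Proof. by rewrite mxE liftK unlift_none. Qed.
Lemma emb3_kl A j : emb3 A k (lift k j) = 0.
Proof. by rewrite mxE liftK unlift_none. Qed.
Lemma emb3_kk A : emb3 A k k = 1.
Proof. by rewrite mxE unlift_none. Qed.
Definition emb3E := (emb3_ll, emb3_lk, emb3_kl, emb3_kk).

Lemma sum_lift (V : nmodType) (F : 'I_3 -> V) :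
  \sum_i F i = F k + \sum_j F (lift k j).
Proof. by rewrite (bigD1_ord k). Qed.

Lemma emb3M A B : emb3 (A *m B) = emb3 A *m emb3 B.
Proof.
apply/matrixP => i j; rewrite [RHS]mxE sum_lift.
case: (ordD i) => [->|[i' ->]]; case: (ordD j) => [->|[j' ->]];
  rewrite !emb3E.
- by rewrite big1 ?mulr1 ?addr0// => l _; rewrite !emb3E mul0r.
- by rewrite mulr0 big1 ?addr0// => l _; rewrite !emb3E mul0r.
- by rewrite mul0r big1 ?addr0// => l _; rewrite !emb3E mulr0.
- by rewrite mul0r add0r mxE; apply: eq_bigr => l _; rewrite !emb3E.
Qed.

Lemma emb3_1 : emb3 1%:M = 1%:M.
Proof.
apply/matrixP => i j; rewrite [RHS]mxE.
case: (ordD i) => [->|[i' ->]]; case: (ordD j) => [->|[j' ->]];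
  rewrite !emb3E ?eqxx//.
- by rewrite (negPf (neq_lift _ _)).
- by rewrite eq_sym (negPf (neq_lift _ _)).
- by rewrite mxE (inj_eq (@lift_inj _ k)).
Qed.

Lemma emb3_star (conj : {additive K -> K}) A : conj 1 = 1 ->
  star conj (emb3 A) = emb3 (star conj A).
Proof.
move=> c1; apply/matrixP => i j; rewrite [LHS]mxE mxE.
case: (ordD i) => [->|[i' ->]]; case: (ordD j) => [->|[j' ->]];
by rewrite !emb3E ?c1 ?raddf0// !mxE.
Qed.

Lemma mul_basis M i : (M *m basis_vec K k.+1) i 0 = M i k.
Proof.
rewrite mxE (bigD1 k)//= big1 => [|l lk]; last first.
  by rewrite !mxE eqSS (inj_eq val_inj) (negPf lk) mulr0.
by rewrite !mxE eqxx mulr1 addr0.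
Qed.

Lemma emb3_basis A : emb3 A *m basis_vec K k.+1 = basis_vec K k.+1.
Proof.
apply/colP => i; rewrite mul_basis [RHS]mxE eqSS (inj_eq val_inj).
case: (ordD i) => [->|[i' ->]]; rewrite emb3E ?eqxx//.
by rewrite eq_sym (negPf (neq_lift _ _)).
Qed.

Lemma res2K (conj : {additive K -> K}) M : conj 1 = 1 ->
  unitary_mx conj M -> M *m basis_vec K k.+1 = basis_vec K k.+1 ->
  emb3 (res2 M) = M.
Proof.
move=> c1 uM Mk.
have Mik i : M i k = (i == k)%:R.
  by rewrite -[LHS]mul_basis Mk [LHS]mxE eqSS (inj_eq val_inj).
apply/matrixP => i j.
case: (ordD i) => [->|[i' ->]]; case: (ordD j) => [->|[j' ->]];
  rewrite !emb3E ?mxE//.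
- by rewrite Mik eqxx.
(* Orthogonality of column [k], which is a basis vector, to the other columns says that the rest of
   row [k] vanishes. *)
- have := congr1 (fun A : 'M[K]_3 => A k (lift k j')) uM; rewrite !mxE.
  rewrite sum_lift !mxE Mik eqxx c1 mul1r big1 ?addr0.
    by rewrite (negPf (neq_lift _ _)).
  by move=> l _; rewrite !mxE Mik eq_sym (negPf (neq_lift _ _)) raddf0 mul0r.
- by rewrite Mik eq_sym (negPf (neq_lift _ _)).
Qed.

End Embed.

(** * Entrywise continuity *)

Section MatrixContinuity.
Variables (U T : topologicalType) (m n : nat).

Lemma mx_continuous (h : T -> 'M[U]_(m, n)) :
  (forall i j, continuous (fun t => h t i j)) -> continuous h.
Proof.
move=> hc t A [P PM sPA].
(* A basic neighbourhood restricts each entry separately, so its preimage contains a finite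
   intersection of neighbourhoods. *)
apply: (@filterS _ _ _ (\bigcap_(ij in [set` [fset x in predT]%fset])
    [set s | P ij.1 ij.2 (h s ij.1 ij.2)])).
  by move=> s Ps; apply: sPA => i j; apply: (Ps (i, j)); rewrite /= !inE.
by apply: filter_bigI => -[i j] _; apply: hc; exact: PM.
Qed.

Lemma entry_continuous i j : continuous (fun M : 'M[U]_(m, n) => M i j).
Proof.
move=> M A MA; exists (fun i' j' => if (i' == i) && (j' == j) then A else setT).
  by move=> i' j'; case: andP => [[/eqP -> /eqP ->]|_]; last exact: filterT.
by move=> N /(_ i j); rewrite !eqxx.
Qed.

End MatrixContinuity.

Lemma continuous_sum (T : topologicalType) (R : realType) (I : finType)
    (F : I -> T -> R) :
  (forall i, continuous (F i)) -> continuous (fun t => \sum_i F i t).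
Proof.
by move=> Fc t; apply: cvg_big => [|i _]; [exact: add_continuous|exact: Fc].
Qed.

(** * Spin groups as unitary groups *)

(* K is R, C or H with its real scalars [sc], conjugation and real part; the
   pair [vr], [vk] identifies R^n isometrically with R + K. *)
Record spin_algebra (R : realType) (K : nzRingType) (n : nat) := SpinAlgebra {
  sc : {rmorphism R -> K};
  conj : {additive K -> K};
  re : {additive K -> R};
  vr : 'rV[R]_n -> R;
  vk : 'rV[R]_n -> K;
  scC : forall r x, sc r * x = x * sc r;
  conjM : forall x y, conj (x * y) = conj y * conj x;
  conjK : involutive conj;
  conj_sc : forall r, conj (sc r) = sc r;
  reZ : forall r x, re (sc r * x) = r * re x;
  reC : forall x y, re (x * y) = re (y * x);
  re1 : re 1 = 1;
  mul_conj : forall x, x * conj x = sc (re (x * conj x));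
  re_ge0 : forall x, 0 <= re (x * conj x);
  re_eq0 : forall x, re (x * conj x) = 0 -> x = 0;
  vr_lin : forall a v w, vr (a *: v + w) = a * vr v + vr w;
  vk_lin : forall a v w, vk (a *: v + w) = sc a * vk v + vk w;
  sqnormE : forall v, sqnorm v = vr v ^+ 2 + re (vk v * conj (vk v));
  vrk_surj : forall t w, exists2 v, vr v = t & vk v = w }.

Section GenericSpin.
Variables (R : realType) (K : nzRingType) (n : nat) (D : spin_algebra R K n).
Local Notation sc := (sc D).
Local Notation conj := (conj D).
Local Notation re := (re D).
Local Notation vr := (vr D).
Local Notation vk := (vk D).
Local Notation star := (star conj).
Local Notation unitary := (unitary_mx conj).
Implicit Types (v w : 'rV[R]_n) (x y : clifford R n).

Definition nsq (x : K) : R := re (x * conj x).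

Lemma mul_conjE (x : K) : x * conj x = sc (nsq x). Proof. exact: mul_conj. Qed.
Lemma nsq_conj (x : K) : nsq (conj x) = nsq x.
Proof. by rewrite /nsq conjK reC. Qed.
Lemma conj_mulE (x : K) : conj x * x = sc (nsq x).
Proof. by rewrite -nsq_conj -mul_conjE conjK. Qed.

Lemma conj_one : conj 1 = 1.
Proof. by rewrite -(rmorph1 sc) conj_sc. Qed.

Lemma re_sc r : re (sc r) = r.
Proof. by rewrite -[sc r]mulr1 reZ re1 mulr1. Qed.

Lemma sc_inj : injective sc.
Proof. by move=> a b /(congr1 re); rewrite !re_sc. Qed.

(** In [x * (y * conj y) * conj x] the middle factor is a real scalar, hence central. *)
Lemma nsqM (x y : K) : nsq (x * y) = nsq x * nsq y.
Proof.
apply: sc_inj; rewrite -mul_conjE conjM mulrA -(mulrA x) mul_conjE -scC -mulrA.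
by rewrite mul_conjE -rmorphM mulrC.
Qed.

Lemma nsq_sc r : nsq (sc r) = r ^+ 2.
Proof. by rewrite /nsq conj_sc reZ re_sc. Qed.

Lemma nsqN (x : K) : nsq (- x) = nsq x.
Proof. by rewrite /nsq raddfN mulrNN. Qed.

Definition vmx v : 'M[K]_2 :=
  mx2 (sc (vr v)) (vk v) (conj (vk v)) (- sc (vr v)).

Lemma vmx_lin a v w : vmx (a *: v + w) = (sc a)%:M *m vmx v + vmx w.
Proof.
rewrite /vmx mul_scalar_mx mx2Z mx2D vr_lin vk_lin; congr mx2.
- by rewrite rmorphD rmorphM.
- by rewrite raddfD conjM conj_sc scC.
- by rewrite rmorphD rmorphM opprD mulrN.
Qed.

Lemma vmx_star v : star (vmx v) = vmx v.
Proof. by rewrite mx2_star conjK raddfN conj_sc. Qed.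

Lemma vmx_sqr v : vmx v *m vmx v = (sc (sqnorm v))%:M.
Proof.
rewrite mx2M mx2_1 (sqnormE D) -/(nsq _); congr mx2.
- by rewrite mul_conjE -rmorphM -rmorphD expr2.
- by rewrite mulrN -scC subrr.
- by rewrite -scC mulNr subrr.
- by rewrite conj_mulE mulrNN -rmorphM -rmorphD expr2 addrC.
Qed.

(* [vmx v] squares to |v|^2; the doubling turns this into - |v|^2. *)
Definition gen (v : 'rV[R]_n) : 'M[K]_(2 + 2) := block_mx 0 (vmx v) (- vmx v) 0.

Definition dblk (Y : 'M[K]_2) : 'M[K]_(2 + 2) := block_mx Y 0 0 Y.

Definition iota4 : {rmorphism R -> 'M[K]_(2 + 2)} :=
  [the {rmorphism R -> 'M[K]_(2 + 2)} of (@scalar_mx K (2 + 2)) \o sc].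

Lemma iota4C r (b : 'M[K]_(2 + 2)) : iota4 r * b = b * iota4 r.
Proof.
rewrite /iota4 /= -!mulmxE mul_scalar_mx; apply/matrixP => i j.
rewrite !mxE (bigD1 j)//= big1 ?addr0.
  by rewrite !mxE eqxx mulr1n scC.
by move=> l lj; rewrite !mxE (negPf lj) mulr0n mulr0.
Qed.

Lemma gen_lin a v w : gen (a *: v + w) = iota4 a * gen v + gen w.
Proof.
rewrite /gen /iota4 /= -mulmxE scalar_mx_block mulmx_block add_block_mx.
by rewrite !mul0mx !mulmx0 !addr0 !add0r vmx_lin mulmxN opprD.
Qed.

Lemma gen0 : gen 0 = 0.
Proof.
have := gen_lin 0 0 0; rewrite scale0r addr0 rmorph0 mul0r add0r.
have := gen_lin 1 0 0; rewrite scale1r addr0 rmorph1 mul1r => /eqP.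
by rewrite -subr_eq subrr => /eqP <-.
Qed.

Lemma gen_sqr v : gen v * gen v = - iota4 (sqnorm v).
Proof.
rewrite -mulmxE mulmx_block !mul0mx !mulmx0 !addr0 !add0r mulNmx mulmxN vmx_sqr.
by rewrite /iota4 /= scalar_mx_block opp_block_mx !oppr0.
Qed.

Definition geni (i : 'I_n) := gen (delta_mx 0 i).

Lemma sqnorm_delta (i : 'I_n) : sqnorm (delta_mx 0 i : 'rV[R]_n) = 1.
Proof.
rewrite /sqnorm (bigD1 i)//= big1 ?addr0 => [|j ji].
  by rewrite mxE !eqxx expr1n.
by rewrite mxE (negPf ji) andbF expr0n.
Qed.

Lemma geni_sqr i : geni i * geni i = -1.
Proof. by rewrite gen_sqr sqnorm_delta rmorph1. Qed.

Lemma geniC (i j : 'I_n) : i != j -> geni i * geni j = - (geni j * geni i).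
Proof.
(* Polarize [gen_sqr]. *)
move=> ij; have := gen_sqr (1 *: delta_mx 0 i + delta_mx 0 j).
rewrite gen_lin rmorph1 mul1r mulrDl !mulrDr !gen_sqr !sqnorm_delta.
have -> : sqnorm (1 *: delta_mx 0 i + delta_mx 0 j) = 1 + 1 :> R.
  rewrite /sqnorm (bigD1 i)//= (bigD1 j) 1?eq_sym//= big1 => [|k /andP[ki kj]].
    by rewrite !mxE !eqxx (negPf ij) eq_sym (negPf ij) /=; ring.
  by rewrite !mxE (negPf ki) (negPf kj) /=; ring.
rewrite rmorphD rmorph1 opprD (addrC (gen _ * gen _) (- 1)) addrACA.
rewrite -[RHS]addr0 => /addrI h.
by apply/eqP; rewrite -addr_eq0; apply/eqP.
Qed.

Definition rep (x : clifford R n) : 'M[K]_(2 + 2) := cl_rep iota4 geni x.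

Lemma rep_vec v : rep (cl_vec v) = gen v.
Proof.
rewrite /rep (cl_rep_vec iota4C geni_sqr geniC) /gen_vec.
rewrite {2}[v]row_sum_delta.
apply/esym; elim/big_rec2: _ => [|i a b _ <-]; first exact: gen0.
by rewrite gen_lin.
Qed.

(** Over a noncommutative K the trace is not cyclic, but its real part is. *)
Definition tr4 : {additive 'M[K]_(2 + 2) -> R} :=
  [the {additive 'M[K]_(2 + 2) -> R} of re \o mxtrace].

Lemma tr4Z r b : tr4 (iota4 r * b) = r * tr4 b.
Proof.
rewrite /tr4 /iota4 /= -mulmxE mul_scalar_mx /mxtrace !raddf_sum mulr_sumr.
by apply: eq_bigr => i _; rewrite mxE reZ.
Qed.

Lemma tr4C a b : tr4 (a * b) = tr4 (b * a).
Proof.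
rewrite /tr4 /= -!mulmxE /mxtrace.
under eq_bigr do rewrite mxE.
under [in RHS]eq_bigr do rewrite mxE.
rewrite !raddf_sum; under eq_bigr do rewrite raddf_sum.
under [in RHS]eq_bigr do rewrite raddf_sum.
rewrite exchange_big; apply: eq_bigr => i _; apply: eq_bigr => j _.
exact: reC.
Qed.

Lemma tr4_1 : tr4 1 != 0.
Proof.
rewrite -[1](rmorph1 iota4) -[iota4 1]mulr1 tr4Z mul1r /tr4 /= mxtrace1.
by rewrite raddfMn re1 pnatr_eq0.
Qed.

(** The generators are block antidiagonal, so this serves as the grading element [omega]. *)
Definition omega4 : 'M[K]_(2 + 2) := block_mx 1%:M 0 0 (- 1%:M).

Lemma omega4_sqr : omega4 * omega4 = 1.
Proof.
rewrite -mulmxE mulmx_block !mul0mx !mulmx0 !addr0 !add0r.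
rewrite mulNmx mulmxN opprK !mul1mx.
by rewrite -scalar_mx_block.
Qed.

Lemma omega4C i : omega4 * geni i = - (geni i * omega4).
Proof.
rewrite -!mulmxE !mulmx_block !mul0mx !mulmx0 !addr0 !add0r.
by rewrite !(mulmxN, mulNmx) !mulmx1 !mul1mx opp_block_mx !oppr0 opprK.
Qed.

Definition unrep (b : 'M[K]_(2 + 2)) : clifford R n := cl_unrep geni tr4 b.

Lemma repK : cancel rep unrep.
Proof.
exact: (cl_repK iota4C geni_sqr geniC tr4Z tr4C tr4_1 omega4_sqr omega4C).
Qed.

Lemma repM x y : rep (x * y) = rep x * rep y.
Proof. exact: (cl_repM iota4C geni_sqr geniC). Qed.

Lemma rep1 : rep 1 = 1.
Proof. exact: cl_rep1. Qed.

Lemma dblkM Y Z : dblk Y * dblk Z = dblk (Y *m Z).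
Proof. by rewrite -mulmxE mulmx_block !mul0mx !mulmx0 !addr0 !add0r. Qed.

(** A spin element acts by two equal diagonal blocks, so one block determines it. *)
Definition low (x : clifford R n) : 'M[K]_2 := ulsubmx (rep x).

Lemma rep_vec2 v w : rep (cl_vec v * cl_vec w) = dblk (- (vmx v *m vmx w)).
Proof.
rewrite repM !rep_vec -mulmxE mulmx_block !mul0mx !mulmx0 !addr0 !add0r.
by rewrite mulmxN mulNmx.
Qed.

Lemma low_vec2 v w : low (cl_vec v * cl_vec w) = - (vmx v *m vmx w).
Proof. by rewrite /low rep_vec2 block_mxKul. Qed.

Lemma low1 : low 1 = 1%:M.
Proof. by rewrite /low rep1 -[1]/(1%:M) scalar_mx_block block_mxKul. Qed.

Lemma rep_Spin x : Spin R n x -> rep x = dblk (low x).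
Proof.
move: x; apply: Spin_ind => [|v w x _ _ IH].
  by rewrite low1 rep1 /dblk -scalar_mx_block.
by rewrite repM rep_vec2 IH dblkM /low repM rep_vec2 IH dblkM !block_mxKul.
Qed.

Lemma lowM x y : Spin R n x -> Spin R n y -> low (x * y) = low x *m low y.
Proof.
by move=> xS yS; rewrite {1}/low repM !rep_Spin// dblkM block_mxKul.
Qed.

Lemma vmx_surj t (w : K) : exists v,
  vmx v = mx2 (sc t) w (conj w) (- sc t) /\ sqnorm v = t ^+ 2 + nsq w.
Proof.
have [v vt vw] := vrk_surj D t w.
by exists v; rewrite /vmx (sqnormE D) vt vw.
Qed.

Lemma low_unitary x : Spin R n x ->
  star (low x) *m low x = 1%:M /\ low x *m star (low x) = 1%:M.
Proof.
(* [vmx v] for a unit vector is a Hermitian involution, and unitaries are closed under products and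
   signs. Both one-sided identities are carried along, as K need not be commutative. *)
pose U (Y : 'M[K]_2) := star Y *m Y = 1%:M /\ Y *m star Y = 1%:M.
have UM Y Z : U Y -> U Z -> U (Y *m Z).
  move=> [y1 y2] [z1 z2]; split; rewrite starM; try exact: conjM.
    by rewrite -mulmxA [star Y *m _]mulmxA y1 mul1mx.
  by rewrite -mulmxA [Z *m _]mulmxA z2 mul1mx.
have Uv v : sqnorm v = 1 -> U (vmx v).
  by move=> v1; rewrite /U vmx_star vmx_sqr v1 rmorph1.
have UN Y : U Y -> U (- Y).
  rewrite /U; have -> : star (- Y) = - star Y.
    by apply/matrixP => i j; rewrite !mxE raddfN.
  by rewrite !(mulmxN, mulNmx) !opprK.
(* Membership in [Spin] is kept in the induction, since [lowM] requires it. *)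
move=> xS; suff : Spin R n x /\ U (low x) by case.
move: x xS; apply: Spin_ind => [|v w x v1 w1 [xS Ux]].
  split; first exact: Spin1.
  rewrite low1 /U star1 ?mul1mx//; [exact: conjM|exact: conjK].
split; first by apply: SpinM => //; exact: Spin_vec2.
rewrite lowM//; last exact: Spin_vec2.
by rewrite low_vec2; apply: (UM) => //; apply: UN; apply: UM; apply: Uv.
Qed.

Lemma diag_conj p : nsq p = 1 ->
  exists2 x, Spin R n x & low x = mx2 p 0 0 (conj p).
Proof.
move=> p1.
(* The matrix of [v] is antidiagonal with upper entry -p and that of [w] swaps the two coordinates;
   minus their product is diag(p, p'). *)
have [v [vE vn]] := vmx_surj 0 (- p); have [w [wE wn]] := vmx_surj 0 1.
exists (cl_vec v * cl_vec w).
  apply: Spin_vec2; first by rewrite vn nsqN p1 expr0n add0r.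
  by rewrite wn /nsq conj_one mulr1 re1 expr0n add0r.
rewrite low_vec2 vE wE mx2M mx2N conj_one raddfN rmorph0.
by rewrite !(mul0r, mulr0, mulr1, add0r, addr0, oppr0, opprK).
Qed.

Lemma real_rot t (w : K) : t ^+ 2 + nsq w = 1 ->
  exists2 x, Spin R n x & low x = mx2 (sc t) w (- conj w) (sc t).
Proof.
move=> tw.
(* Right multiplication by the matrix diag(1, -1) of [e] negates the second column of that of [v];
   with the sign of [low_vec2] this is the rotation. *)
have [v [vE vn]] := vmx_surj (- t) w; have [e [eE en]] := vmx_surj 1 0.
exists (cl_vec v * cl_vec e).
  apply: Spin_vec2; first by rewrite vn sqrrN.
  by rewrite en /nsq mul0r raddf0 expr1n addr0.
rewrite low_vec2 vE eE mx2M mx2N raddf0 rmorph1 rmorphN.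
by rewrite !(mulrN1, mulr0, mulr1, add0r, addr0, oppr0, opprK).
Qed.

Lemma polar (x : K) : exists2 p, nsq p = 1 & x = p * sc (Num.sqrt (nsq x)).
Proof.
have [->|x0] := eqVneq x 0.
  exists 1; first by rewrite /nsq conj_one mulr1 re1.
  by rewrite /nsq mul0r raddf0 sqrtr0 rmorph0 mulr0.
have xp : 0 < nsq x.
  by rewrite lt_def re_ge0 andbT; apply: contraNneq x0 => /re_eq0 ->.
exists (x * sc (Num.sqrt (nsq x))^-1).
  by rewrite nsqM nsq_sc exprVn sqr_sqrtr ?ltW// mulfV// gt_eqF.
by rewrite -mulrA -rmorphM mulVf ?rmorph1 ?mulr1// gt_eqF// sqrtr_gt0.
Qed.

Lemma Spin_transitive a c : nsq a + nsq c = 1 ->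
  exists x, [/\ Spin R n x, low x 0 0 = a & low x 1 0 = c].
Proof.
move=> ac; have [p p1 aE] := polar a.
have [x xS xE] := diag_conj p1.
(* The lower left entry of [low y] is [p * c], which the factor diag(p, p') on the left sends back
   to [c]. *)
have [|y yS yE] := @real_rot (Num.sqrt (nsq a)) (- (conj c * conj p)).
  by rewrite sqr_sqrtr ?re_ge0// nsqN nsqM !nsq_conj p1 mulr1.
exists (x * y); split; first exact: SpinM.
  rewrite lowM// xE yE mx2M !mxE /= mul0r addr0; exact/esym.
rewrite lowM// xE yE mx2M !mxE /= mul0r add0r raddfN conjM.
rewrite !conjK opprK.
by rewrite mulrA conj_mulE p1 rmorph1 mul1r.
Qed.

(** This provides the factor fixing e_1 in [decomposition], where (b, c) is a column of arbitrary
    length to be reached from a multiple of the second basis vector. *)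
Lemma Spin_transitive2 b c : exists x s,
  [/\ Spin R n x, 0 <= s, s ^+ 2 = nsq b + nsq c,
      low x 0 1 * sc s = b & low x 1 1 * sc s = c].
Proof.
have bc0 : 0 <= nsq b + nsq c by rewrite addr_ge0 ?re_ge0.
have [/eqP|n0] := eqVneq (nsq b + nsq c) 0.
  rewrite paddr_eq0 ?re_ge0// => /andP[/eqP b0 /eqP c0].
  exists 1, 0; rewrite b0 c0 rmorph0 !mulr0.
  rewrite (re_eq0 b0) (re_eq0 c0) expr0n addr0.
  by split=> //; exact: Spin1.
pose s := Num.sqrt (nsq b + nsq c).
have s0 : s != 0 by rewrite sqrtr_eq0 -ltNge lt_def n0.
have [|x [xS xb xc]] := @Spin_transitive (- b * sc s^-1) (- c * sc s^-1).
  rewrite !nsqM !nsqN !nsq_sc -mulrDl exprVn sqr_sqrtr// mulfV//.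
(* The quarter turn [y] moves the first column to the second with a minus sign, which is why a
   multiple of (-b, -c) was reached first. *)
have [|y yS yE] := @real_rot 0 (- 1).
  by rewrite nsqN /nsq conj_one mulr1 re1 expr0n add0r.
exists (x * y), s; split.
- exact: SpinM.
- exact: sqrtr_ge0.
- by rewrite sqr_sqrtr.
- rewrite lowM// yE [low x]mx2P xb xc mx2M !mxE /= !rmorph0 mulr0 addr0.
  by rewrite mulrN1 !mulNr opprK -mulrA -rmorphM mulVf// rmorph1 mulr1.
- rewrite lowM// yE [low x]mx2P xb xc mx2M !mxE /= !rmorph0 mulr0 addr0.
  by rewrite mulrN1 !mulNr opprK -mulrA -rmorphM mulVf// rmorph1 mulr1.
Qed.

(* The condition cutting the special group out of the unitary one: determinant 1
   over R and C, no condition over H. *)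
Record special (P : 'M[K]_3 -> Prop) : Prop := Special {
  special1 : P 1%:M;
  specialM : forall A B, P A -> P B -> P (A *m B);
  special_cancel : forall A B, P A -> P (A *m B) -> P B;
  special_vec2 : forall (k : 'I_3) v w, sqnorm v = 1 -> sqnorm w = 1 ->
    P (emb3 k (- (vmx v *m vmx w)));
  special_diag : forall (k : 'I_3) q, nsq q = 1 -> P (emb3 k (mx2 1 0 0 q)) ->
    exists2 x, Spin R n x & low x = mx2 1 0 0 q }.

(** * Stabilisers as spin groups, and the decomposition *)

Section SpecialGroup.
Variables (P : 'M[K]_3 -> Prop) (sP : special P).

Definition fixer (k : nat) : set 'M[K]_3 :=
  [set A | (unitary A /\ P A) /\ A *m basis_vec K k = basis_vec K k].

Lemma unitary_emb3 k (Y : 'M[K]_2) : unitary (emb3 k Y) <-> unitary Y.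
Proof.
rewrite /unitary_mx emb3_star ?conj_one// -emb3M.
split=> [|->]; last by rewrite emb3_1.
by rewrite -(emb3_1 K k) => /(can_inj (emb3K k)).
Qed.

Lemma emb3_low_fixer (k : 'I_3) x : Spin R n x -> fixer k.+1 (emb3 k (low x)).
Proof.
move=> xS; split; last exact: emb3_basis.
split; first by apply/unitary_emb3; case: (low_unitary xS).
suff : Spin R n x /\ P (emb3 k (low x)) by case.
move: x xS; apply: Spin_ind => [|v w x v1 w1 [xS Px]].
  by split; [exact: Spin1|rewrite low1 emb3_1; exact: special1].
have vwS := Spin_vec2 v1 w1; split; first exact: SpinM.
rewrite lowM// emb3M low_vec2.
by apply: (specialM sP) => //; exact: special_vec2.
Qed.

(** Dividing the 2 x 2 block by a spin element with the same first column leaves a unitary matrix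
    with first column e_1, that is diag(1, q), to which [special_diag] applies. *)
Lemma fixer_low (k : 'I_3) M : fixer k.+1 M ->
  exists2 x, Spin R n x & M = emb3 k (low x).
Proof.
move=> [[uM PM'] Mk]; have ME := res2K conj_one uM Mk.
set B := res2 k M in ME; rewrite -ME in uM PM' *.
have {}uM := (unitary_emb3 k B).1 uM.
have B00 : nsq (B 0 0) + nsq (B 1 0) = 1.
  have := congr1 (fun A : 'M[K]_2 => re (A 0 0)) uM.
  rewrite !mxE !big_ord_recl big_ord0 !mxE addr0 raddfD re1 /=.
  by rewrite !conj_mulE !re_sc lift00.
have [x [xS x0 x1]] := Spin_transitive B00.
have [Y1 Y2] := low_unitary xS.
set Y := low x in Y1 Y2 x0 x1.
pose Z := star Y *m B.
have BE : B = Y *m Z by rewrite mulmxA Y2 mul1mx.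
have uZ : unitary Z.
  rewrite /Z /unitary_mx starM ?starK; try exact: conjM; last exact: conjK.
  by rewrite -mulmxA [Y *m _]mulmxA Y2 mul1mx.
(* [x] was chosen so that [Y] and [B] share the first column, so that of [Z] equals that of
   [star Y *m Y]. *)
have Zc i : Z i 0 = (1%:M : 'M[K]_2) i 0.
  rewrite -Y1 [LHS]mxE [RHS]mxE; apply: eq_bigr => j _; congr (_ * _).
  by case: (ord2_case j) => ->; [rewrite x0|rewrite x1].
have ZE : Z = mx2 1 0 0 (Z 1 1).
  rewrite [LHS]mx2P; congr mx2; rewrite ?Zc ?mxE//.
  (* Orthogonality of the columns of [Z] kills its upper right entry. *)
  have := congr1 (fun A : 'M[K]_2 => A 0 1) uZ.
  rewrite [Z]mx2P mx2_star mx2M !Zc !mxE /= conj_one raddf0 mul1r mul0r addr0.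
  by [].
have q1 : nsq (Z 1 1) = 1.
  have := congr1 (fun A : 'M[K]_2 => re (A 1 1)) uZ.
  rewrite ZE mx2_star mx2M !mxE /= raddf0 mul0r add0r conj_mulE re_sc re1.
  by [].
have [|y yS yE] := special_diag sP (k := k) q1.
  (* [P] passes from [B] to [Z] by cancelling the spin factor [Y]. *)
  rewrite -ZE; apply: (special_cancel sP (A := emb3 k Y));
    last by rewrite -emb3M -BE.
  by have [[_ ?] _] := emb3_low_fixer k xS.
by exists (x * y); [exact: SpinM|rewrite lowM// yE -ZE -BE].
Qed.

Definition to_spin (k : 'I_3) (M : 'M[K]_3) : clifford R n :=
  unrep (dblk (res2 k M)).

Definition of_spin (k : 'I_3) (x : clifford R n) : 'M[K]_3 := emb3 k (low x).

Lemma of_spinK k x : Spin R n x -> to_spin k (of_spin k x) = x.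
Proof. by move=> xS; rewrite /to_spin emb3K -rep_Spin// repK. Qed.

Lemma spin_iso (k : 'I_3) :
  [/\ set_fun (fixer k.+1) (Spin R n) (to_spin k) /\
      set_fun (Spin R n) (fixer k.+1) (of_spin k),
      (forall M, fixer k.+1 M -> of_spin k (to_spin k M) = M) /\
      (forall x, Spin R n x -> to_spin k (of_spin k x) = x) &
      forall M N, fixer k.+1 M -> fixer k.+1 N ->
        to_spin k (M *m N) = to_spin k M * to_spin k N].
Proof.
split; first split.
- by move=> M /fixer_low[x xS ->]; rewrite of_spinK.
- by move=> x xS; exact: emb3_low_fixer.
- split; last by move=> x; exact: of_spinK.
  by move=> M /fixer_low[x xS ->]; rewrite of_spinK.
- move=> M N /fixer_low[x xS ->] /fixer_low[y yS ->].
  by rewrite -emb3M -lowM// !of_spinK//; exact: SpinM.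
Qed.

Lemma decomposition (A : 'M[K]_3) : unitary A -> P A ->
  exists A1 A2 A1' : 'M[K]_3,
    [/\ fixer 1 A1, fixer 1 A1', fixer 2 A2 & A = A1 *m A2 *m A1'].
Proof.
move=> uA PA; pose k0 : 'I_3 := 0; pose k1 : 'I_3 := 1.
pose a := A 0 0; pose b := A (lift k0 0) 0; pose c := A (lift k0 1) 0.
have abc : nsq a + (nsq b + nsq c) = 1.
  have := congr1 (fun A : 'M[K]_3 => re (A 0 0)) uA.
  rewrite !mxE (sum_lift k0) !big_ord_recl big_ord0 !mxE addr0 !raddfD re1 /=.
  by rewrite !conj_mulE !re_sc lift00.
have [x [s [xS s0 sE xb xc]]] := Spin_transitive2 b c.
have [|y [yS ya yc]] := @Spin_transitive a (sc s).
  by rewrite nsq_sc sE.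
have F1 := emb3_low_fixer k0 xS; have F2 := emb3_low_fixer k1 yS.
have [X1 X2] := low_unitary xS; have [Y1 Y2] := low_unitary yS.
set A1 := emb3 k0 (low x) in F1; set A2 := emb3 k1 (low y) in F2.
have E1 : A1 *m star A1 = 1%:M.
  by rewrite /A1 emb3_star ?conj_one// -emb3M X2 emb3_1.
have E2 : A2 *m star A2 = 1%:M.
  by rewrite /A2 emb3_star ?conj_one// -emb3M Y2 emb3_1.
(* The third factor is A_2^-1 A_1^-1 A, with stars for inverses. *)
exists A1, A2, (star A2 *m star A1 *m A).
have AE : A = A1 *m A2 *m (star A2 *m star A1 *m A).
  by rewrite -!mulmxA (mulmxA A2) E2 mul1mx mulmxA E1 mul1mx.
(* Removing coordinate 1 leaves coordinates 0 and 2, removing coordinate 0 leaves 1 and 2; this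
   matches the entries of the two embeddings. *)
have e0 : 0 = lift k1 0 :> 'I_3 by exact: val_inj.
have e1 : lift k0 0 = k1 by exact: val_inj.
have e2 : lift k0 1 = lift k1 1 by exact: val_inj.
have A2_0 : A2 0 0 = a by rewrite /A2 e0 emb3E ya.
have A2_1 : A2 (lift k0 0) 0 = 0 by rewrite /A2 e0 e1 emb3E.
have A2_2 : A2 (lift k0 1) 0 = sc s by rewrite /A2 e0 e2 emb3E yc.
have A12 i : (A1 *m A2) i 0 = A i 0.
  rewrite mxE (sum_lift k0) !big_ord_recl big_ord0 addr0 lift00 A2_0 A2_1 A2_2.
  rewrite mulr0 add0r; case: (ordD k0 i) => [->|[i' ->]]; rewrite /A1 !emb3E.
    by rewrite mul1r mul0r addr0.
  by rewrite mul0r add0r; case: (ord2_case i') => ->.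
(* [A1 *m A2] and [A] have the same first column, so the third factor fixes e_1. *)
have A12b : A1 *m A2 *m basis_vec K 1 = A *m basis_vec K 1.
  by apply/colP => i; rewrite !(mul_basis k0) A12.
split=> //; split; last first.
  rewrite -mulmxA -A12b -!mulmxA (mulmxA (star A1)).
  have [[uA1 _] _] := F1; have [[uA2 _] _] := F2.
  by rewrite uA1 mul1mx mulmxA uA2 mul1mx.
split.
  rewrite /unitary_mx !starM ?starK; try exact: conjM; try exact: conjK.
  rewrite -!mulmxA (mulmxA A2) E2 mul1mx (mulmxA A1) E1 mul1mx //.
apply: (special_cancel sP (A := A1 *m A2)); last by rewrite -AE.
by case: F1 F2 => -[_ PA1] _ [[_ PA2] _]; apply: (specialM sP).
Qed.

End SpecialGroup.

(** * Continuity of the isomorphism and its inverse *)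

Lemma re_mul_sc (c z : K) r : re (c * (sc r * z)) = r * re (c * z).
Proof. by rewrite mulrA -scC -mulrA reZ. Qed.

Lemma tr4_dblk (b : 'M[K]_(2 + 2)) (Y : 'M[K]_2) : tr4 (b * dblk Y) =
  \sum_i \sum_j re ((ulsubmx b + drsubmx b) i j * Y j i).
Proof.
rewrite /tr4 /= -mulmxE -[b in LHS]submxK mulmx_block !mulmx0 !addr0 !add0r.
rewrite mxtrace_block -mxtraceD -mulmxDl /mxtrace raddf_sum.
by apply: eq_bigr => i _; rewrite mxE raddf_sum.
Qed.

(** Each Clifford coordinate is a trace against a fixed monomial, a finite sum of terms
    [re (c * h t i j)]. Phrasing continuity through these functionals keeps the topology of K out of
    the argument. *)
Lemma to_spin_continuous k (T : topologicalType) (h : T -> 'M[K]_3) :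
  (forall c i j, continuous (fun t => re (c * h t i j))) ->
  continuous (fun t => to_spin k (h t)).
Proof.
move=> hc; apply: (@mx_continuous R T 1 _ (fun t => to_spin k (h t))) => i j.
set S := enum_val j; set b : 'M[K]_(2 + 2) := monom geni S.
rewrite (_ : (fun t => _) = fun t => cl_sign R S S / tr4 1 *
    \sum_i \sum_j re ((ulsubmx b + drsubmx b) i j * h t (lift k j) (lift k i))).
  move=> t; apply: cvgMl_tmp; move: t; apply: continuous_sum => i'.
  by apply: continuous_sum => j'; exact: hc.
apply/funext => t; rewrite mxE tr4_dblk; congr (_ * _).
by apply: eq_bigr => i' _; apply: eq_bigr => j' _; rewrite [res2 _ _ _ _]mxE.
Qed.

Lemma of_spin_continuous k c i j :
  continuous (fun x : clifford R n => re (c * of_spin k x i j)).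
Proof.
(* Row and column [k] of the embedded matrix are constant; only the inner block depends on [x],
   linearly. *)
have cst (f : clifford R n -> K) z : (forall x, f x = z) ->
    continuous (fun x => re (c * f x)).
  move=> fz; rewrite (_ : (fun x => _) = fun=> re (c * z)); first
    exact: cst_continuous.
  by apply/funext => x; rewrite fz.
case: (ordD k i) => [->|[i' ->]]; case: (ordD k j) => [->|[j' ->]].
- by apply: (cst _ 1) => x; exact: emb3_kk.
- by apply: (cst _ 0) => x; exact: emb3_kl.
- by apply: (cst _ 0) => x; exact: emb3_lk.
rewrite (_ : (fun x => _) = fun x => \sum_S cl_coord x S *
    re (c * (monom geni S : 'M[K]_(2 + 2)) (lshift 2 i') (lshift 2 j'))).
  apply: continuous_sum => S x; apply: cvgMr_tmp; first exact: nbhs_filter.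
  exact (@entry_continuous R 1 #|{set 'I_n}| 0 (enum_rank S) x).
apply/funext => x; rewrite /of_spin emb3E !mxE /rep /cl_rep.
rewrite summxE mulr_sumr raddf_sum.
apply: eq_bigr => S _; rewrite -re_mul_sc; congr (re (_ * _)).
by rewrite /iota4 /= -mulmxE mul_scalar_mx mxE.
Qed.

End GenericSpin.

(** * The real, complex and quaternionic cases *)

Section Determinant.
Variable K : comNzRingType.

Lemma det_mx2 (a b c d : K) : \det (mx2 a b c d) = a * d - b * c.
Proof.
rewrite (expand_det_row _ 0) !big_ord_recl big_ord0 addr0 /cofactor !det_mx11.
by rewrite !mxE /= expr0 expr1 mul1r mulN1r mulrN.
Qed.

Lemma det_emb3 k (A : 'M[K]_2) : \det (emb3 k A) = \det A.
Proof.
rewrite (expand_det_row _ k) (sum_lift k) emb3E mul1r big1 ?addr0 => [|j _].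
  rewrite /cofactor addnn -signr_odd odd_double expr0 mul1r.
  by congr (\det _); apply/matrixP => i j; rewrite !mxE -[RHS](emb3_ll k) mxE.
by rewrite emb3E mul0r.
Qed.

Variables (R : realType) (n : nat) (D : spin_algebra R K n).

(** In size two the factor -1 does not change the determinant, and [vmx] of a unit vector has
    determinant -1. *)
Lemma det_vec2 k v w : sqnorm v = 1 -> sqnorm w = 1 ->
  \det (emb3 k (- (vmx D v *m vmx D w))) = 1.
Proof.
have dv u : sqnorm u = 1 -> \det (vmx D u) = -1.
  move=> u1; rewrite det_mx2 mulrN mul_conjE -rmorphM -opprD -rmorphD -expr2.
  by rewrite -(sqnormE D) u1 rmorph1.
move=> v1 w1; rewrite det_emb3 -scaleN1r detZ sqrrN expr1n mul1r.
rewrite det_mulmx !dv//.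
by rewrite mulrNN mulr1.
Qed.

Lemma det_special : special D (fun A => \det A = 1).
Proof.
split=> [|A B|A B|k v w|k q _]; first exact: det1.
- by rewrite det_mulmx => -> ->; rewrite mulr1.
- by rewrite det_mulmx => ->; rewrite mul1r.
- exact: det_vec2.
rewrite det_emb3 det_mx2 mul1r mulr0 subr0 => ->.
by exists 1; [exact: Spin1|rewrite low1 mx2_1].
Qed.

End Determinant.

(** * K = R, n = 2 *)

Section RealCase.
Variable R : realType.

Lemma real_spin_algebra : exists D : spin_algebra R R 2,
  conj D =1 id /\ re D =1 id.
Proof.
unshelve eexists (@SpinAlgebra R R 2 idfun idfun idfun
  (fun v => v 0 0) (fun v => v 0 1)
  _ _ _ _ _ _ _ _ _ _ _ _ _ _) => //=.
- exact: mulrC.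
- by move=> x y; rewrite mulrC.
- by move=> x y; rewrite mulrC.
- by move=> x; rewrite -expr2 sqr_ge0.
- by move=> x /eqP; rewrite mulf_eq0 orbb => /eqP.
- by move=> a v w; rewrite !mxE.
- by move=> a v w; rewrite !mxE.
- move=> v; rewrite /sqnorm !big_ord_recl big_ord0 addr0 -expr2.
  by rewrite (_ : lift 0 0 = 1)//; exact: val_inj.
- move=> t w; exists (\row_i if i == 0 then t else w); by rewrite mxE.
Qed.

End RealCase.

(** * K = C, n = 3 *)

Section ComplexCase.
Variable R : realType.

Let Re_add : zmod_morphism (@complex.Re R).
Proof. by move=> [a b] [c d]. Qed.
HB.instance Definition _ :=
  GRing.isZmodMorphism.Build R[i] R (@complex.Re R) Re_add.

Let Im_add : zmod_morphism (@complex.Im R).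
Proof. by move=> [a b] [c d]. Qed.
HB.instance Definition _ :=
  GRing.isZmodMorphism.Build R[i] R (@complex.Im R) Im_add.

Lemma complex_spin_algebra : exists D : spin_algebra R R[i] 3,
  conj D =1 Num.conj /\ re D =1 @complex.Re R.
Proof.
unshelve eexists (@SpinAlgebra R R[i] 3 (real_complex R) Num.conj
  (@complex.Re R)
  (fun v => v 0 0) (fun v => (v 0 1 +i* v 0 2)%C)
  _ _ _ _ _ _ _ _ _ _ _ _ _ _) => //=.
- by move=> r x; rewrite mulrC.
- by move=> x y; rewrite rmorphM mulrC.
- exact: conjCK.
- by move=> r; exact: conjc_real.
- by move=> r [a b] /=; rewrite mul0r subr0.
- by move=> x y; rewrite mulrC.
- move=> [a b]; apply/eqP; rewrite eq_complex /= eqxx /=.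
  by rewrite mulrN mulrC addNr.
- by move=> [a b] /=; rewrite mulrN opprK addr_ge0// -expr2 sqr_ge0.
- move=> [a b] /= /eqP; rewrite mulrN opprK paddr_eq0 -?expr2 ?sqr_ge0//.
  by rewrite !sqrf_eq0 => /andP[/eqP -> /eqP ->].
- by move=> a v w; rewrite !mxE.
- move=> a v w; rewrite !mxE; apply/eqP; rewrite eq_complex /=.
  by rewrite !mul0r subr0 addr0 !eqxx.
- move=> v; rewrite /sqnorm !big_ord_recl big_ord0 addr0 /=.
  rewrite (_ : lift 0 0 = 1)//; last exact: val_inj.
  rewrite (_ : lift 0 _ = 2%:R); last exact: val_inj.
  by rewrite mulrN opprK !expr2.
- move=> t [a b]; exists (\row_i if i == 0 then t else if i == 1 then a else b);
    by rewrite !mxE.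
Qed.

(** Additivity makes the bound a Lipschitz condition. It is stated inside [R[i]], where the norm
    takes its values. *)
Lemma norm_bounded_continuous (f : {additive R[i] -> R}) :
  (forall z, `|f z|%:C%C <= `|z|) -> continuous f.
Proof.
move=> fle; suff fc : continuous (f : R[i]^o -> R) by exact: fc.
move=> z; apply/(@cvgrPdist_lt _ _ _ (nbhs z) (nbhs_filter z)) => e e0.
have : \forall w \near z, `|z - w| < e%:C%C by apply: nbhsx_ballx; rewrite ltcR.
by apply: filterS => w; rewrite -raddfB => /(le_lt_trans (fle _)); rewrite ltcR.
Qed.

Lemma Re_continuous : continuous (@complex.Re R).
Proof.
apply: norm_bounded_continuous => z.
by rewrite normc_def lecR -sqrtr_sqr ler_wsqrtr// lerDl sqr_ge0.
Qed.

Lemma Im_continuous : continuous (@complex.Im R).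
Proof.
apply: norm_bounded_continuous => z.
by rewrite normc_def lecR -sqrtr_sqr ler_wsqrtr// lerDr sqr_ge0.
Qed.

Lemma complex_continuous (T : topologicalType) (h : T -> R[i]) :
  continuous (fun t => complex.Re (h t)) ->
  continuous (fun t => complex.Im (h t)) ->
  continuous h.
Proof.
move=> hr hi t.
have : (h : T -> R[i]^o) s @[s --> t] --> (h t : R[i]^o).
  apply/cvgrPdist_lt => e e0.
  (* The radius [e] lies in [R[i]]; being positive it is real, and half its real part is allotted to
     each component. *)
  have eE : e = (complex.Re e)%:C%C by rewrite RRe_real// gtr0_real.
  have e2 : 0 < complex.Re e / 2 by rewrite divr_gt0// -ltcR -eE.
  near=> s.
  have : `|complex.Re (h t) - complex.Re (h s)| +
         `|complex.Im (h t) - complex.Im (h s)| < complex.Re e.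
    rewrite [ltRHS]splitr ltrD//; near: s.
      by have /cvgrPdist_lt/(_ _ e2) := hr t.
    by have /cvgrPdist_lt/(_ _ e2) := hi t.
  rewrite -ltcR -eE; apply: le_lt_trans.
  rewrite -!raddfB normc_def lecR -[leRHS]ger0_norm ?addr_ge0//.
  rewrite -sqrtr_sqr ler_wsqrtr// sqrrD !real_normK ?num_real//.
  by rewrite lerD2r lerDl mulrn_wge0// mulr_ge0.
by [].
Unshelve. all: by end_near. Qed.

Lemma complex_re_continuous c : continuous (fun x : R[i] => complex.Re (c * x)).
Proof.
rewrite (_ : (fun x => _) = fun x =>
    complex.Re c * complex.Re x - complex.Im c * complex.Im x).
  move=> x; apply: (@cvgB _ _ _ _ (nbhs_filter x));
    apply: (@cvgMl_tmp _ _ _ (nbhs_filter x)).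
    exact: Re_continuous.
  exact: Im_continuous.
by apply/funext => -[a b]; case: c.
Qed.

Lemma complex_continuous_re (T : topologicalType) (h : T -> R[i]) :
  (forall c, continuous (fun t => complex.Re (c * h t))) -> continuous h.
Proof.
move=> hc; apply: complex_continuous.
  by have := hc 1; under eq_fun do rewrite mul1r.
(* Multiplying by -i turns the imaginary part into the real part. *)
have := hc (- 'i%C).
rewrite (_ : (fun t => complex.Re _) = fun t => complex.Im (h t))//.
by apply/funext => t; case: (h t) => a b /=; ring.
Qed.

End ComplexCase.

Arguments quat_conj {R} x : simpl never.

(** * K = H, n = 5 *)

Section QuaternionCase.
Variable R : realType.

(* A bare tuple is elaborated in the product ring, where multiplication is
   componentwise; [qmk] pins the type [quat R]. *)
Definition qmk (a b c d : R) : quat R := (a, b, c, d).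
Definition quat_sc (r : R) : quat R := qmk r 0 0 0.
Definition quat_re (x : quat R) : R := x.1.1.1.

Variant quat_spec : quat R -> Type :=
  QuatSpec a b c d : quat_spec (qmk a b c d).

Lemma quatP (x : quat R) : quat_spec x.
Proof. by case: x => [[[a b] c] d]; exact: (QuatSpec a b c d). Qed.

Lemma qmkD (a b c d a' b' c' d' : R) :
  qmk a b c d + qmk a' b' c' d' = qmk (a + a') (b + b') (c + c') (d + d').
Proof. by []. Qed.

Lemma qmkN (a b c d : R) : - qmk a b c d = qmk (- a) (- b) (- c) (- d).
Proof. by []. Qed.

Lemma qmk_conj (a b c d : R) :
  quat_conj (qmk a b c d) = qmk a (- b) (- c) (- d).
Proof. by []. Qed.

Lemma qmk_re (a b c d : R) : quat_re (qmk a b c d) = a.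
Proof. by []. Qed.

Lemma qmkM (a b c d a' b' c' d' : R) : qmk a b c d * qmk a' b' c' d' = qmk
  (a * a' - b * b' - c * c' - d * d') (a * b' + b * a' + c * d' - d * c')
  (a * c' - b * d' + c * a' + d * b') (a * d' + b * c' - c * b' + d * a').
Proof. by []. Qed.

Let quat_sc_additive : zmod_morphism quat_sc.
Proof. by move=> r s; rewrite /quat_sc qmkN qmkD; congr qmk; ring. Qed.
HB.instance Definition _ :=
  GRing.isZmodMorphism.Build R (quat R) quat_sc quat_sc_additive.

Let quat_sc_multiplicative : monoid_morphism quat_sc.
Proof. by split=> // r s; rewrite /quat_sc qmkM; congr qmk; ring. Qed.
HB.instance Definition _ :=
  GRing.isMonoidMorphism.Build R (quat R) quat_sc quat_sc_multiplicative.

Let quat_conj_additive : zmod_morphism (@quat_conj R).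
Proof.
move=> x y; case: (quatP x) => a b c d; case: (quatP y) => a' b' c' d'.
by rewrite qmkN qmkD !qmk_conj qmkN qmkD; congr qmk; ring.
Qed.
HB.instance Definition _ :=
  GRing.isZmodMorphism.Build (quat R) (quat R) (@quat_conj R)
    quat_conj_additive.

Let quat_re_additive : zmod_morphism quat_re.
Proof. by move=> [[[a b] c] d] [[[a' b'] c'] d']. Qed.
HB.instance Definition _ :=
  GRing.isZmodMorphism.Build (quat R) R quat_re quat_re_additive.

Lemma quat_norm (a b c d : R) :
  quat_re (qmk a b c d * quat_conj (qmk a b c d)) =
  a ^+ 2 + b ^+ 2 + c ^+ 2 + d ^+ 2.
Proof. by rewrite qmk_conj qmkM qmk_re; ring. Qed.

Lemma quat_spin_algebra : exists D : spin_algebra R (quat R) 5,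
  conj D =1 @quat_conj R /\ re D =1 quat_re.
Proof.
unshelve eexists (@SpinAlgebra R (quat R) 5 quat_sc (@quat_conj R) quat_re
  (fun v => v 0 0) (fun v => qmk (v 0 1) (v 0 2) (v 0 3) (v 0 4))
  _ _ _ _ _ _ _ _ _ _ _ _ _ _); last by [].
- move=> r x; case: (quatP x) => a b c d.
  by rewrite /quat_sc /= !qmkM; congr qmk; ring.
- move=> x y; case: (quatP x) => a b c d; case: (quatP y) => a' b' c' d'.
  by rewrite /= !(qmkM, qmk_conj); congr qmk; ring.
- by move=> x; case: (quatP x) => a b c d; rewrite /= !qmk_conj !opprK.
- by move=> r; rewrite /= /quat_sc qmk_conj oppr0.
- move=> r x; case: (quatP x) => a b c d.
  by rewrite /= /quat_sc qmkM !qmk_re; ring.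
- move=> x y; case: (quatP x) => a b c d; case: (quatP y) => a' b' c' d'.
  by rewrite /= !qmkM !qmk_re; ring.
- by [].
- move=> x; case: (quatP x) => a b c d.
  by rewrite /= quat_norm qmk_conj qmkM; congr qmk; ring.
- move=> x; case: (quatP x) => a b c d; rewrite /= quat_norm.
  by rewrite !addr_ge0// sqr_ge0.
- move=> x; case: (quatP x) => a b c d; rewrite /= quat_norm => /eqP.
  rewrite !paddr_eq0 ?addr_ge0 ?sqr_ge0// !sqrf_eq0.
  by move=> /andP[/andP[/andP[/eqP -> /eqP ->] /eqP ->] /eqP ->].
- by move=> a v w; rewrite /= !mxE.
- by move=> a v w; rewrite /= !mxE /quat_sc qmkM qmkD; congr qmk; ring.
- move=> v; rewrite /= quat_norm /sqnorm !big_ord_recl big_ord0 addr0 !addrA.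
  by congr (_ + v 0 _ ^+ 2 + v 0 _ ^+ 2 + v 0 _ ^+ 2 + v 0 _ ^+ 2);
    exact: val_inj.
- move=> t x; case: (quatP x) => a b c d.
  by exists (\row_i nth 0 [:: t; a; b; c; d] i); rewrite !mxE.
Qed.

(** The root is (1 + q) / |1 + q|: since q q' = 1, (1 + q)^2 = (2 + 2 Re q) q, and |1 + q|^2 = 2 + 2
    Re q. *)
Lemma quat_sqrt (q : quat R) : quat_re (q * quat_conj q) = 1 ->
  exists2 p : quat R, quat_re (p * quat_conj p) = 1 & p * p = q.
Proof.
case: (quatP q) => a b c d; rewrite quat_norm => q1.
have [a1|a1] := eqVneq a (- 1).
  (* Real part -1 and norm 1 force q = -1, where 1 + q vanishes; i is a square root. *)
  exists (qmk 0 1 0 0); first by rewrite quat_norm; ring.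
  have : b ^+ 2 + c ^+ 2 + d ^+ 2 == 0 by apply/eqP; move: q1; rewrite a1; lra.
  rewrite !paddr_eq0 ?addr_ge0 ?sqr_ge0// !sqrf_eq0.
  move=> /andP[/andP[/eqP -> /eqP ->] /eqP ->].
  by rewrite a1 qmkM; congr qmk; ring.
have b0 := sqr_ge0 b; have c0 := sqr_ge0 c; have d0 := sqr_ge0 d.
have a_gt : 0 < 2 + 2 * a.
  have : - 1 < a by rewrite lt_def a1 /=; nra.
  lra.
pose s := (Num.sqrt (2 + 2 * a))^-1.
have s2 : s ^+ 2 * (2 + 2 * a) = 1.
  by rewrite exprVn sqr_sqrtr ?mulVf ?gt_eqF// ltW.
have e : b ^+ 2 + c ^+ 2 + d ^+ 2 = 1 - a ^+ 2 by lra.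
exists (qmk ((1 + a) * s) (b * s) (c * s) (d * s)).
  rewrite quat_norm -[RHS]s2.
  transitivity (s ^+ 2 * ((1 + a) ^+ 2 + (b ^+ 2 + c ^+ 2 + d ^+ 2))).
    by ring.
  by rewrite e; ring.
rewrite qmkM; congr qmk.
- transitivity (s ^+ 2 * ((1 + a) ^+ 2 - (b ^+ 2 + c ^+ 2 + d ^+ 2))).
    by ring.
  rewrite e; transitivity (s ^+ 2 * (2 + 2 * a) * a); first by ring.
  by rewrite s2 mul1r.
- by transitivity (s ^+ 2 * (2 + 2 * a) * b); [ring|rewrite s2 mul1r].
- by transitivity (s ^+ 2 * (2 + 2 * a) * c); [ring|rewrite s2 mul1r].
- by transitivity (s ^+ 2 * (2 + 2 * a) * d); [ring|rewrite s2 mul1r].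
Qed.

(** Supplies in [quat_imaginary_factor] an imaginary unit x i + y j orthogonal to a given
    quaternion. *)
Lemma orthogonal_unit (b c : R) :
  exists x y, x ^+ 2 + y ^+ 2 = 1 /\ x * b + y * c = 0.
Proof.
have [bc0|bc0] := eqVneq (b ^+ 2 + c ^+ 2) 0.
  exists 1, 0; move: bc0 => /eqP; rewrite paddr_eq0 ?sqr_ge0// !sqrf_eq0.
  by move=> /andP[/eqP -> /eqP ->]; split; ring.
pose r := (Num.sqrt (b ^+ 2 + c ^+ 2))^-1.
exists (c * r), (- b * r); split; last by ring.
rewrite !exprMn sqrrN -mulrDl exprVn sqr_sqrtr ?addr_ge0 ?sqr_ge0//.
by rewrite addrC mulfV.
Qed.

(** Take u = x i + y j orthogonal to p and v = -u p. As u^2 = -1, u v = p; the real part of u p is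
    -(x b + y c) = 0, so v is imaginary. *)
Lemma quat_imaginary_factor (p : quat R) : quat_re (p * quat_conj p) = 1 ->
  exists u v : quat R, [/\ quat_re (u * quat_conj u) = 1,
    quat_re (v * quat_conj v) = 1, quat_conj u = - u, quat_conj v = - v
    & u * v = p].
Proof.
case: (quatP p) => a b c d; rewrite quat_norm => p1.
have [x [y [xy1 xy0]]] := orthogonal_unit b c.
have ux : qmk 0 x y 0 * qmk 0 x y 0 = - 1.
  rewrite -[1]/(qmk 1 0 0 0) qmkN oppr0 qmkM -xy1.
  by congr qmk; ring.
exists (qmk 0 x y 0), (- (qmk 0 x y 0 * qmk a b c d)); split.
- by rewrite quat_norm -xy1; ring.
- rewrite qmkM qmkN quat_norm -[RHS]mulr1 -{1}xy1 -p1.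
  transitivity ((x ^+ 2 + y ^+ 2) * (a ^+ 2 + b ^+ 2 + c ^+ 2 + d ^+ 2)).
    by ring.
  by ring.
- by rewrite qmk_conj qmkN oppr0.
- rewrite qmkM !qmkN qmk_conj; congr qmk; rewrite ?opprK//.
  by move: xy0; lra.
- by rewrite mulrN mulrA ux mulN1r opprK.
Qed.

Lemma quat_diag (D : spin_algebra R (quat R) 5) (q : quat R) :
  conj D =1 @quat_conj R -> re D =1 quat_re -> nsq D q = 1 ->
  exists2 x, Spin R 5 x & low D x = mx2 1 0 0 q.
Proof.
move=> cD rD; have nE x : nsq D x = quat_re (x * quat_conj x).
  by rewrite /nsq rD cD.
rewrite nE => /quat_sqrt[p p1 <-].
have [u [v [u1 v1 cu cv uv]]] := quat_imaginary_factor p1.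
rewrite -!nE in p1 u1 v1.
have [|x xS xE] := @diag_conj _ _ _ D (conj D p); first by rewrite nsq_conj.
have [y yS yE] := diag_conj u1; have [z zS zE] := diag_conj v1.
exists (x * (y * z)); first by do 2?apply: SpinM.
rewrite !lowM//; last exact: SpinM.
rewrite xE yE zE !mx2M !(mul0r, mulr0, addr0, add0r) conjK uv.
(* [u] and [v] being imaginary, u' v' = u v = p, so the lower right entry is p^2 while the upper
   left is p' p = 1. *)
by rewrite conj_mulE p1 rmorph1 !cD cu cv mulrNN uv.
Qed.

Lemma quat_comp_continuous :
  [/\ continuous (fun x : quat R => x.1.1.1),
      continuous (fun x : quat R => x.1.1.2),
      continuous (fun x : quat R => x.1.2)
    & continuous (fun x : quat R => x.2)].
Proof.
have c1 : continuous (fun x : quat R => x.1) by move=> x; exact: cvg_fst.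
have c11 : continuous (fun x : quat R => x.1.1).
  by move=> x; apply: (cvg_comp _ _ (c1 x)); exact: cvg_fst.
split=> x.
- by apply: (cvg_comp _ _ (c11 x)); exact: cvg_fst.
- by apply: (cvg_comp _ _ (c11 x)); exact: cvg_snd.
- by apply: (cvg_comp _ _ (c1 x)); exact: cvg_snd.
- exact: cvg_snd.
Qed.

Lemma quat_re_continuous (c : quat R) : continuous (fun x => quat_re (c * x)).
Proof.
have [ca cb cc cd] := quat_comp_continuous.
case: (quatP c) => a b c' d.
rewrite (_ : (fun x => _) = fun x : quat R =>
   a * x.1.1.1 - b * x.1.1.2 - c' * x.1.2 - d * x.2); last first.
  by apply/funext => x; case: (quatP x) => a' b' c'' d'; rewrite qmkM qmk_re.
move=> x; do 3?[apply: cvgB]; apply: cvgMl_tmp.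
- exact: ca.
- exact: cb.
- exact: cc.
- exact: cd.
Qed.

Lemma quat_continuous (T : topologicalType) (h : T -> quat R) :
  (forall c, continuous (fun t => quat_re (c * h t))) -> continuous h.
Proof.
move=> hc.
(* The multipliers 1, -i, -j, -k extract the four coordinates as real parts. *)
rewrite (_ : h = fun t =>
   (quat_re (qmk 1 0 0 0 * h t), quat_re (qmk 0 (- 1) 0 0 * h t),
   quat_re (qmk 0 0 (- 1) 0 * h t), quat_re (qmk 0 0 0 (- 1) * h t))).
  move=> t.
  apply: (cvg_pair (cvg_pair (cvg_pair (hc _ t) (hc _ t)) (hc _ t)) (hc _ t)).
apply/funext => t; case: (quatP (h t)) => a b c d; rewrite !qmkM !qmk_re.
by rewrite /qmk; congr (_, _, _, _); ring.
Qed.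

End QuaternionCase.

(** * The three classical families of groups *)

Section Cases.
Variable R : realType.

Lemma real_case :
  (forall k : nat, k = 1%N \/ k = 2%N ->
     top_group_iso (SO_ R k) (Spin R 2) mulmx *%R) /\
  (forall A : 'M[R]_3, SO R 3 A ->
     exists A1 A2 A1' : 'M[R]_3,
       [/\ SO_ R 1 A1, SO_ R 1 A1', SO_ R 2 A2 & A = A1 *m A2 *m A1']).
Proof.
have [D [cD rD]] := real_spin_algebra R.
have uE (A : 'M[R]_3) : unitary_mx (conj D) A <-> A^T *m A = 1%:M.
  suff -> : A^T = star (conj D) A by [].
  by apply/matrixP => i j; rewrite !mxE cD.
have FE k : fixer D (fun A => \det A = 1) k = SO_ R k.
  by apply/seteqP; split=> A [[/uE uA dA] Ak].
have sP := det_special D.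
split=> [|A [/uE uA dA]]; last first.
  by have := decomposition sP uA dA; rewrite !FE.
suff iso (k : 'I_3) : top_group_iso (SO_ R k.+1) (Spin R 2) mulmx *%R.
  by move=> k [->|->]; [exact: (iso 0)|exact: (iso 1)].
have := spin_iso sP k.
rewrite FE => -[fg fgK fM]; exists (to_spin D k), (of_spin D k); split=> //.
  apply: continuous_subspaceT; apply: to_spin_continuous => c i j M.
  rewrite (_ : (fun _ => _) = fun M : 'M[R]_3 => c * M i j); last first.
    by apply/funext => N; rewrite rD.
  apply: (cvg_comp _ _ (@entry_continuous _ _ _ i j M)).
  exact: mulrl_continuous.
apply: continuous_subspaceT; apply: mx_continuous => i j.
rewrite (_ : (fun _ => _) = fun x => re D (1 * of_spin D k x i j)).
  exact: of_spin_continuous.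
by apply/funext => x; rewrite mul1r rD.
Qed.

Lemma complex_case :
  (forall k : nat, k = 1%N \/ k = 2%N ->
     top_group_iso (SU_ R k) (Spin R 3) mulmx *%R) /\
  (forall A : 'M[R[i]]_3, SU R 3 A ->
     exists A1 A2 A1' : 'M[R[i]]_3,
       [/\ SU_ R 1 A1, SU_ R 1 A1', SU_ R 2 A2 & A = A1 *m A2 *m A1']).
Proof.
have [D [cD rD]] := complex_spin_algebra R.
have uE (A : 'M[R[i]]_3) : unitary_mx (conj D) A <-> (A ^t*)%sesqui *m A = 1%:M.
  suff -> : (A ^t*)%sesqui = star (conj D) A by [].
  by apply/matrixP => i j; rewrite !mxE cD.
have FE k : fixer D (fun A => \det A = 1) k = SU_ R k.
  by apply/seteqP; split=> A [[/uE uA dA] Ak].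
have sP := det_special D.
split=> [|A [/uE uA dA]]; last first.
  by have := decomposition sP uA dA; rewrite !FE.
suff iso (k : 'I_3) : top_group_iso (SU_ R k.+1) (Spin R 3) mulmx *%R.
  by move=> k [->|->]; [exact: (iso 0)|exact: (iso 1)].
have := spin_iso sP k.
rewrite FE => -[fg fgK fM]; exists (to_spin D k), (of_spin D k); split=> //.
  apply: continuous_subspaceT; apply: to_spin_continuous => c i j M.
  rewrite (_ : (fun _ => _) = fun M : 'M[R[i]]_3 =>
      complex.Re (c * M i j)); last first.
    by apply/funext => N; rewrite rD.
  exact (@continuous_comp _ _ _ (fun N : 'M[R[i]]_3 => N i j)
    (fun x => complex.Re (c * x)) M
    (@entry_continuous _ 3 3 i j M) (@complex_re_continuous R c (M i j))).
apply: continuous_subspaceT; apply: mx_continuous => i j.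
apply: complex_continuous_re => c.
rewrite (_ : (fun _ => _) = fun x => re D (c * of_spin D k x i j)).
  exact: of_spin_continuous.
by apply/funext => x; rewrite rD.
Qed.

Lemma quaternion_case :
  (forall k : nat, k = 1%N \/ k = 2%N ->
     top_group_iso (Sp_ R k) (Spin R 5) mulmx *%R) /\
  (forall A : 'M[quat R]_3, Sp R 3 A ->
     exists A1 A2 A1' : 'M[quat R]_3,
       [/\ Sp_ R 1 A1, Sp_ R 1 A1', Sp_ R 2 A2 & A = A1 *m A2 *m A1']).
Proof.
have [D [cD rD]] := quat_spin_algebra R.
have uE (A : 'M[quat R]_3) :
    unitary_mx (conj D) A <-> map_mx (@quat_conj R) A^T *m A = 1%:M.
  suff -> : map_mx (@quat_conj R) A^T = star (conj D) A by [].
  by apply/matrixP => i j; rewrite !mxE cD.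
have FE k : fixer D (fun=> True) k = Sp_ R k.
  by apply/seteqP; split=> [A [[/uE uA _] Ak]|A [/uE uA Ak]].
have sP : special D (fun=> True).
  by split=> // k q q1 _; exact: quat_diag.
split=> [|A /uE uA]; last first.
  by have := decomposition sP uA I; rewrite !FE.
suff iso (k : 'I_3) : top_group_iso (Sp_ R k.+1) (Spin R 5) mulmx *%R.
  by move=> k [->|->]; [exact: (iso 0)|exact: (iso 1)].
have := spin_iso sP k.
rewrite FE => -[fg fgK fM]; exists (to_spin D k), (of_spin D k); split=> //.
  apply: continuous_subspaceT; apply: to_spin_continuous => c i j M.
  rewrite (_ : (fun _ => _) = fun M : 'M[quat R]_3 =>
      quat_re (c * M i j)); last first.
    by apply/funext => N; rewrite rD.
  exact (@continuous_comp _ _ _ (fun N : 'M[quat R]_3 => N i j)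
    (fun x => quat_re (c * x)) M
    (@entry_continuous _ 3 3 i j M) (@quat_re_continuous R c (M i j))).
apply: continuous_subspaceT; apply: mx_continuous => i j.
apply: quat_continuous => c.
rewrite (_ : (fun _ => _) = fun x => re D (c * of_spin D k x i j)).
  exact: of_spin_continuous.
by apply/funext => x; rewrite rD.
Qed.

End Cases.

Theorem theorem1 (R : realType) :
  [/\ (* (1) *)
      (forall k : nat, k = 1%N \/ k = 2%N ->
         top_group_iso (SO_ R k) (Spin R 2) mulmx *%R) /\
      (forall A : 'M[R]_3, SO R 3 A ->
         exists A1 A2 A1' : 'M[R]_3,
           [/\ SO_ R 1 A1, SO_ R 1 A1', SO_ R 2 A2 & A = A1 *m A2 *m A1']),
      (* (2) *)
      (forall k : nat, k = 1%N \/ k = 2%N ->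
         top_group_iso (SU_ R k) (Spin R 3) mulmx *%R) /\
      (forall A : 'M[R[i]]_3, SU R 3 A ->
         exists A1 A2 A1' : 'M[R[i]]_3,
           [/\ SU_ R 1 A1, SU_ R 1 A1', SU_ R 2 A2 & A = A1 *m A2 *m A1'])
    & (* (3) *)
      (forall k : nat, k = 1%N \/ k = 2%N ->
         top_group_iso (Sp_ R k) (Spin R 5) mulmx *%R) /\
      (forall A : 'M[quat R]_3, Sp R 3 A ->
         exists A1 A2 A1' : 'M[quat R]_3,
           [/\ Sp_ R 1 A1, Sp_ R 1 A1', Sp_ R 2 A2 & A = A1 *m A2 *m A1'])].
Proof.
by split; [exact: real_case|exact: complex_case|exact: quaternion_case].
Qed.
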